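(* Any Möbius interval is a Rezk complete Segal space.
   Context: **Simplicial preliminaries.** $\mathcal S$ is the $\infty$-category of $\infty$-groupoids; all notions are homotopy invariant. A map of $\infty$-groupoids is a monomorphism if its fibres are empty or contractible. $\Delta$ is the category of nonempty finite ordinals $[n]=\{0<\dots<n\}$. A map $a:[m]\to[n]$ in $\Delta$ is active if $a(0)=0$, $a(m)=n$; inert if $a(i+1)=a(i)+1$ for $0\le i\le m-1$. A simplicial space is a decomposition space if it takes all pushouts in $\Delta$ of active maps along inert maps to pullbacks; complete if moreover $s_0:X_0\to X_1$ is a monomorphism. A simplicial space is Segal if $X_n\simeq X_1\times_{X_0}\cdots\times_{X_0}X_1$ for all $n\geq 1$; a Segal space is Rezk complete if $s_0$ identifies $X_0$ with the full subgroupoid of $X_1$ consisting of the equivalences (arrows invertible up to homotopy). **Finiteness and the Möbius condition.** An $\infty$-groupoid is locally finite if at each base point all homotopy groups $\pi_i$, $i\ge1$, are finite and are trivial for $i$ sufficiently large; finite if moreover it has finitely many components. A map of $\infty$-groupoids is finite if all its fibres are finite. A decomposition space $X$ is locally finite if $X_1$ is locally finite and $s_0:X_0\to X_1$ and $d_1:X_2\to X_1$ are finite maps. For $X$ complete, $\vec X_r\subset X_r$ is the full subgroupoid of simplices none of whose $r$ principal edges (given by the inert maps $[1]\to[r]$) is degenerate; the long-edge map $X_r\to X_1$ is induced by the unique active map $[1]\to[r]$. $X$ is tight (of locally finite length) if for each $a\in X_1$ the fibre of $\vec X_r\to X_1$ over $a$ is empty for $r$ sufficiently large. A complete decomposition space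 is Möbius if it is locally finite and tight. **Intervals.** $\Xi$ is (a skeleton of) the category of finite linear orders with distinct bottom and top elements, and monotone maps preserving bottom and top. The object with $k+1$ inner elements $0,\dots,k$ is denoted $[k]$, $k\ge -1$. The functor $i:\Delta\to\Xi$ adjoins a new bottom and top, $i[k]=[k]$; $i^*$ denotes precomposition with $i$. For $n\ge 0$ let $d^\bot,d^\top:[n-1]\to[n]$ be the injections of $\Xi$ skipping the first, respectively last, inner element (for $n=0$ both are $[-1]\to[0]$), and $s^{\bot-1},s^{\top+1}:[n]\to[n-1]$ the surjections sending the first inner element to the bottom, respectively the last inner element to the top, and otherwise bijective. For $A:\Xi^{\mathrm{op}}\to\mathcal S$ lower indices denote the induced maps. $A$ is flanked if for all $n\ge0$ the commutative squares exhibit pullbacks $A_n\simeq A_{n-1}\times_{A_n}A_{n+1}$, formed with $s_{\bot-1}:A_{n-1}\to A_n$ and $d_\top:A_{n+1}\to A_n$ (projections $d_\top$, $s_{\bot-1}$), and likewise with $(s_{\top+1},d_\bot)$ in place of $(s_{\bot-1},d_\top)$. $A$ is a flanked decomposition space if it is flanked and $i^*A$ is a decomposition space; complete if all its degeneracy maps (including $s_{\bot-1},s_{\top+1}$) are monomorphisms; reduced if $A_{-1}\simeq 1$. An algebraic interval is a reduced complete flanked decomposition space. An interval is a decomposition space of the form $i^*A$ with $A$ an algebraic interval. A Möbius interval is an interval which is Möbius as a decomposition space. *)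

(* Defs.v *)
(* Infinity-groupoids are modelled by Kan complexes, and an infinity-functor
   C^op -> S out of an ordinary category C by a strict functor from C^op to Kan
   complexes: every infinity-functor is equivalent to a strict one.  All
   pullbacks and fibres below are homotopy pullbacks and homotopy fibres,
   built from path spaces; they are again Kan complexes. *)

From HB Require Import structures.
From mathcomp Require Import all_boot.
From mathcomp Require Import boolp.

Set Implicit Arguments.
Unset Strict Implicit.
Unset Printing Implicit Defensive.

Record dmap (m n : nat) := DMap {
  dfun :> {ffun 'I_m.+1 -> 'I_n.+1};
  dmono : [forall i : 'I_m.+1, forall j : 'I_m.+1, (i <= j) ==> (dfun i <= dfun j)] }.

HB.instance Definition _ m n := [isSub for @dfun m n].
HB.instance Definition _ m n := [Equality of dmap m n by <:].

Lemma dmapP m n (f g : dmap m n) : f =1 g -> f = g.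
Proof. by move=> e; apply/val_inj/ffunP. Qed.

Lemma dmap_le m n (f : dmap m n) (i j : 'I_m.+1) : i <= j -> f i <= f j.
Proof. by move=> le_ij; exact: (implyP (forallP (forallP (dmono f) i) j)). Qed.

Section Build.
Variables (m n : nat) (f : nat -> nat).
Hypothesis f_bound : forall i, i <= m -> f i <= n.
Hypothesis f_mono : forall i j, i <= j -> j <= m -> f i <= f j.

Definition dmk_fun : {ffun 'I_m.+1 -> 'I_n.+1} :=
  [ffun i : 'I_m.+1 => Ordinal (f_bound (leq_ord i) : f i < n.+1)].

Fact dmk_subproof :
  [forall i : 'I_m.+1, forall j : 'I_m.+1, (i <= j) ==> (dmk_fun i <= dmk_fun j)].
Proof.
apply/forallP => i; apply/forallP => j; apply/implyP => le_ij.
by rewrite !ffunE /=; apply: f_mono => //; exact: leq_ord.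
Qed.

Definition dmk : dmap m n := DMap dmk_subproof.

Lemma dmkE (i : 'I_m.+1) : dmk i = f i :> nat.
Proof. by rewrite ffunE. Qed.
End Build.
Arguments dmk : simpl never.

Definition did n : dmap n n :=
  dmk (f := id) (fun _ h => h) (fun _ _ h _ => h).

Fact dcomp_subproof m n k (g : dmap n k) (f : dmap m n) :
  [forall i : 'I_m.+1, forall j : 'I_m.+1,
     (i <= j) ==> ([ffun i => g (f i)] i <= [ffun i => g (f i)] j)].
Proof.
apply/forallP => i; apply/forallP => j; apply/implyP => le_ij.
by rewrite !ffunE; do 2 apply: dmap_le.
Qed.

Definition dcomp m n k (g : dmap n k) (f : dmap m n) : dmap m k :=
  DMap (dcomp_subproof g f).
Arguments dcomp : simpl never.
Arguments did : simpl never.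

Lemma dcompE m n k (g : dmap n k) (f : dmap m n) i : dcomp g f i = g (f i).
Proof. by rewrite ffunE. Qed.

Lemma didE n i : did n i = i.
Proof. by apply: ord_inj; rewrite dmkE. Qed.

Lemma dcomp_idl m n (f : dmap m n) : dcomp (did n) f = f.
Proof. by apply: dmapP => i; rewrite dcompE didE. Qed.

Lemma dcomp_idr m n (f : dmap m n) : dcomp f (did m) = f.
Proof. by apply: dmapP => i; rewrite dcompE didE. Qed.

Lemma dcompA m n k l (h : dmap k l) (g : dmap n k) (f : dmap m n) :
  dcomp h (dcomp g f) = dcomp (dcomp h g) f.
Proof. by apply: dmapP => i; rewrite !dcompE. Qed.

Definition dconst m n (j : 'I_n.+1) : dmap m n :=
  dmk (f := fun=> j) (fun _ _ => leq_ord j) (fun _ _ _ _ => leqnn j).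

Arguments dconst : simpl never.

Lemma dconst_comp m' m n (j : 'I_n.+1) (f : dmap m' m) :
  dcomp (dconst m j) f = dconst m' j.
Proof. by apply: dmapP => i; apply: ord_inj; rewrite dcompE !dmkE. Qed.

Fact face_bound n i p : p <= n -> bump i p <= n.+1.
Proof. by move=> le_pn; rewrite (leq_add (leq_b1 _) le_pn). Qed.

Fact face_mono n i p q : p <= q -> q <= n -> bump i p <= bump i q.
Proof. by move=> le_pq _; rewrite leq_bump2. Qed.

(* The i-th coface map, for i <= n + 1. *)
Definition face n i : dmap n n.+1 :=
  dmk (@face_bound n i) (@face_mono n i).
Arguments face : simpl never.

Fact degen0_bound n p : p <= n.+1 -> p.-1 <= n.
Proof. by case: p. Qed.

Fact degen0_mono n p q : p <= q -> q <= n.+1 -> p.-1 <= q.-1.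
Proof. by move=> le_pq _; rewrite -!subn1 leq_sub2r. Qed.

Definition degen0 n : dmap n.+1 n :=
  dmk (@degen0_bound n) (@degen0_mono n).
Arguments degen0 : simpl never.

Fact edge_bound r (i : 'I_r) p : p <= 1 -> i + p <= r.
Proof. by move=> le_p1; rewrite (leq_trans _ (ltn_ord i)) // -addn1 leq_add2l. Qed.

Fact edge_mono (i : nat) p q : p <= q -> q <= 1 -> i + p <= i + q.
Proof. by rewrite leq_add2l. Qed.

Definition principal_edge r (i : 'I_r) : dmap 1 r :=
  dmk (@edge_bound r i) (@edge_mono i).
Arguments principal_edge : simpl never.

Fact long_bound r p : p <= 1 -> p * r <= r.
Proof. by case: p => [|[|p]] //; rewrite mul1n. Qed.

Fact long_mono r p q : p <= q -> q <= 1 -> p * r <= q * r.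
Proof. by move=> le_pq _; rewrite leq_mul2r le_pq orbT. Qed.

Definition long_edge r : dmap 1 r := dmk (@long_bound r) (@long_mono r).
Arguments long_edge : simpl never.

Definition active m n (f : dmap m n) : bool :=
  (f ord0 == ord0) && (f ord_max == ord_max).

Definition inert m n (f : dmap m n) : Prop :=
  forall i : 'I_m, f (lift ord0 i) = (f (lift ord_max i)).+1 :> nat.

Record category := Category {
  ob : Type;
  hom : ob -> ob -> Type;
  idm : forall a, hom a a;
  comp : forall a b c, hom b c -> hom a b -> hom a c;
  comp_idl : forall a b (f : hom a b), comp (idm b) f = f;
  comp_idr : forall a b (f : hom a b), comp f (idm a) = f;
  compA : forall a b c d (h : hom c d) (g : hom b c) (f : hom a b),
    comp h (comp g f) = comp (comp h g) f }.

Record functor (C D : category) := Functor {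
  fob :> ob C -> ob D;
  fmor : forall a b, hom a b -> hom (fob a) (fob b);
  fmor_id : forall a, fmor (idm a) = idm (fob a);
  fmor_comp : forall a b c (g : hom b c) (f : hom a b),
    fmor (comp g f) = comp (fmor g) (fmor f) }.

Definition is_pushout (C : category) (a b c d : ob C)
    (f : hom a b) (g : hom a c) (h : hom b d) (k : hom c d) : Prop :=
  comp h f = comp k g /\
  forall (e : ob C) (u : hom b e) (v : hom c e), comp u f = comp v g ->
    exists! w : hom d e, comp w h = u /\ comp w k = v.

Definition Delta : category := Category dcomp_idl dcomp_idr dcompA.

(* The object n of Xi is the linear order with n inner elements, that is
   0 < 1 < ... < n + 1 with bottom 0 and top n + 1; it is written [n - 1] in
   the usual indexing, which starts at -1. *)
Definition xmap (m n : nat) := {f : dmap m.+1 n.+1 | active f}.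

Fact active_id n : active (did n).
Proof. by rewrite /active !didE !eqxx. Qed.

Fact active_comp m n k (g : dmap n k) (f : dmap m n) :
  active g -> active f -> active (dcomp g f).
Proof.
move=> /andP[/eqP g0 /eqP g1] /andP[/eqP f0 /eqP f1].
by rewrite /active !dcompE f0 f1 g0 g1 !eqxx.
Qed.

Definition xid n : xmap n n := Sub (did n.+1) (active_id n.+1).

Definition xcomp m n k (g : xmap n k) (f : xmap m n) : xmap m k :=
  Sub (dcomp (val g) (val f)) (active_comp (valP g) (valP f)).

Lemma xcomp_idl m n (f : xmap m n) : xcomp (xid n) f = f.
Proof. by apply/val_inj/dcomp_idl. Qed.

Lemma xcomp_idr m n (f : xmap m n) : xcomp f (xid m) = f.
Proof. by apply/val_inj/dcomp_idr. Qed.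

Lemma xcompA m n k l (h : xmap k l) (g : xmap n k) (f : xmap m n) :
  xcomp h (xcomp g f) = xcomp (xcomp h g) f.
Proof. by apply/val_inj/dcompA. Qed.

Definition Xi : category := Category xcomp_idl xcomp_idr xcompA.

Fact xdbot_active n : active (face n.+1 1).
Proof. by apply/andP; split; apply/eqP/ord_inj; rewrite dmkE. Qed.

Fact xdtop_active n : active (face n.+1 n.+1).
Proof.
by apply/andP; split; apply/eqP/ord_inj; rewrite dmkE /bump //= leqnn.
Qed.

Fact xsbot_active n : active (degen0 n.+1).
Proof. by apply/andP; split; apply/eqP/ord_inj; rewrite dmkE. Qed.

Fact stop_bound n p : p <= n.+1 -> minn p n <= n.
Proof. by rewrite geq_minr. Qed.

Fact stop_mono n p q : p <= q -> q <= n.+1 -> minn p n <= minn q n.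
Proof. by move=> le_pq _; rewrite leq_min geq_minr andbT geq_min le_pq. Qed.

Fact xstop_active n : active (dmk (@stop_bound n.+1) (@stop_mono n.+1)).
Proof.
apply/andP; split; apply/eqP/ord_inj; rewrite dmkE ?min0n //=.
by apply/minn_idPr.
Qed.

(* The injections skipping the first and the last of the n + 1 inner elements,
   and the surjections sending the first inner element to the bottom and the
   last inner element to the top. *)
Definition xdbot n : xmap n n.+1 := Sub _ (xdbot_active n).
Definition xdtop n : xmap n n.+1 := Sub _ (xdtop_active n).
Definition xsbot n : xmap n.+1 n := Sub _ (xsbot_active n).
Definition xstop n : xmap n.+1 n := Sub _ (xstop_active n).

Definition xsurjective m n (f : xmap m n) : Prop :=
  forall j, exists i, val f i = j.

Definition ext_fun m n (f : dmap m n) (p : nat) : nat :=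
  if p is q.+1 then if q <= m then (f (inord q)).+1 else n.+2 else 0.

Fact ext_bound m n (f : dmap m n) p : p <= m.+2 -> ext_fun f p <= n.+2.
Proof.
by case: p => [|p] //= _; case: ifP => // _; apply: leqW; apply: ltn_ord.
Qed.

Fact ext_mono m n (f : dmap m n) p q :
  p <= q -> q <= m.+2 -> ext_fun f p <= ext_fun f q.
Proof.
move=> le_pq le_qm; case: p le_pq => [|p] //; case: q le_qm => [|q] //= _.
rewrite ltnS => le_pq; case: (leqP q m) => [le_qm|_].
  by rewrite (leq_trans le_pq le_qm) ltnS dmap_le // !inordK ?ltnS ?(leq_trans le_pq).
by case: ifP => // _; apply: leqW; apply: ltn_ord.
Qed.

Fact ext_active m n (f : dmap m n) :
  active (dmk (@ext_bound m n f) (@ext_mono m n f)).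
Proof.
by apply/andP; split; apply/eqP/ord_inj; rewrite dmkE //= ltnn.
Qed.

Definition ext m n (f : dmap m n) : xmap m.+1 n.+1 := Sub _ (ext_active f).

Lemma ext_id n : ext (did n) = xid n.+1.
Proof.
apply/val_inj/dmapP => -[[|p] lt_p]; apply: ord_inj; rewrite !dmkE //=.
case: leqP => [le_pn|lt_np]; first by rewrite didE inordK.
by congr _.+1; apply/eqP; rewrite eqn_leq lt_np -ltnS.
Qed.

Lemma ext_comp m n k (g : dmap n k) (f : dmap m n) :
  ext (dcomp g f) = xcomp (ext g) (ext f).
Proof.
apply/val_inj/dmapP => -[[|p] lt_p]; apply: ord_inj.
  by rewrite dcompE !dmkE.
rewrite dcompE !dmkE /=; case: leqP => [le_pm|_] /=; last by rewrite ltnn.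
by rewrite leq_ord inord_val dcompE.
Qed.

Definition i_functor : functor Delta Xi :=
  @Functor Delta Xi S ext ext_id ext_comp.

Record sset := SSet {
  simp :> nat -> Type;
  act : forall m n, dmap m n -> simp n -> simp m;
  act_id : forall n (x : simp n), act (did n) x = x;
  act_comp : forall m n k (g : dmap n k) (f : dmap m n) (x : simp k),
    act (dcomp g f) x = act f (act g x) }.

Record smap (K L : sset) := SMap {
  sapp :> forall n, K n -> L n;
  sapp_act : forall m n (f : dmap m n) (x : K n),
    sapp (act f x) = act f (sapp x) }.

(* The hypothesis on y says that the faces y i, i != k, agree on their
   intersections, i.e. define a map from the k-th horn of dimension n + 1. *)
Definition is_kan (K : sset) : Prop :=
  forall (n : nat) (k : 'I_n.+2) (y : 'I_n.+2 -> K n),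
    (forall i j : 'I_n.+2, i != k -> j != k ->
      forall m (a b : dmap m n), dcomp (face n i) a = dcomp (face n j) b ->
        act a (y i) = act b (y j)) ->
    exists x : K n.+1, forall i : 'I_n.+2, i != k -> act (face n i) x = y i.

Definition sid (K : sset) : smap K K :=
  @SMap K K (fun n x => x) (fun m n f x => erefl).

Fact scomp_subproof (K L M : sset) (g : smap L M) (f : smap K L) m n
  (a : dmap m n) (x : K n) : g _ (f _ (act a x)) = act a (g _ (f _ x)).
Proof. by rewrite !sapp_act. Qed.

Definition scomp (K L M : sset) (g : smap L M) (f : smap K L) : smap K M :=
  @SMap K M (fun n x => g n (f n x)) (@scomp_subproof K L M g f).

Definition const_simplex (K : sset) n (x : K 0) : K n :=
  act (dconst n ord0) x.

Definition vertex (K : sset) n (j : 'I_n.+1) (x : K n) : K 0 :=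
  act (dconst 0 j) x.

Definition point : sset :=
  @SSet (fun=> unit) (fun _ _ _ x => x) (fun _ _ => erefl)
        (fun _ _ _ _ _ _ => erefl).

Definition to_point (K : sset) : smap K point :=
  @SMap K point (fun _ _ => tt) (fun _ _ _ _ => erefl).

Fact pick_point_subproof (K : sset) (x : K 0) m n (f : dmap m n) :
  const_simplex m x = act f (const_simplex n x).
Proof. by rewrite /const_simplex -act_comp dconst_comp. Qed.

Definition pick_point (K : sset) (x : K 0) : smap point K :=
  @SMap point K (fun n _ => const_simplex n x)
        (fun m n f _ => pick_point_subproof x f).

(* An n-simplex of the path space of K is a simplicial map
   Delta^n x Delta^1 -> K. *)
Record path_simplex (K : sset) (n : nat) := PathSimplex {
  pfun : forall m, dmap m n -> dmap m 1 -> K m;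
  pfun_act : forall m m' (h : dmap m' m) (a : dmap m n) (t : dmap m 1),
    pfun (dcomp a h) (dcomp t h) = act h (pfun a t) }.

Lemma path_simplexP (K : sset) n (p q : path_simplex K n) :
  (forall m (a : dmap m n) (t : dmap m 1), pfun p a t = pfun q a t) -> p = q.
Proof.
case: p q => [p pP] [q qP] /= e.
have {}e : p = q by do 3 apply: functional_extensionality_dep => ?; apply: e.
by case: q / e qP => qP; congr PathSimplex; exact: Prop_irrelevance.
Qed.

Fact path_act_subproof (K : sset) n n' (f : dmap n' n) (p : path_simplex K n)
    m m' (h : dmap m' m) (a : dmap m n') (t : dmap m 1) :
  pfun p (dcomp f (dcomp a h)) (dcomp t h) = act h (pfun p (dcomp f a) t).
Proof. by rewrite dcompA pfun_act. Qed.

Definition path_act (K : sset) n' n (f : dmap n' n) (p : path_simplex K n) :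
    path_simplex K n' :=
  @PathSimplex K n' (fun m a t => pfun p (dcomp f a) t)
    (@path_act_subproof K n n' f p).

Fact path_act_id (K : sset) n (p : path_simplex K n) : path_act (did n) p = p.
Proof. by apply: path_simplexP => m a t /=; rewrite dcomp_idl. Qed.

Fact path_act_comp (K : sset) m n k (g : dmap n k) (f : dmap m n)
  (p : path_simplex K k) : path_act (dcomp g f) p = path_act f (path_act g p).
Proof. by apply: path_simplexP => l a t /=; rewrite dcompA. Qed.

Definition path_space (K : sset) : sset := SSet (@path_act_id K) (@path_act_comp K).

(* The two endpoints: e = ord0 is the start, e = ord_max the end. *)
Definition path_end (K : sset) n (e : 'I_2) (p : path_space K n) : K n :=
  pfun p (did n) (dconst n e).

Lemma path_end_act (K : sset) m n (f : dmap m n) e (p : path_space K n) :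
  path_end e (act f p) = act f (path_end e p).
Proof.
by rewrite /path_end /= -pfun_act dconst_comp dcomp_idl dcomp_idr.
Qed.

Fact const_path_subproof (K : sset) n (x : K n) m m' (h : dmap m' m)
    (a : dmap m n) (t : dmap m 1) :
  act (dcomp a h) x = act h (act a x).
Proof. exact: act_comp. Qed.

Definition const_path (K : sset) n (x : K n) : path_space K n :=
  @PathSimplex K n (fun m a _ => act a x) (@const_path_subproof K n x).

Lemma const_path_act (K : sset) m n (f : dmap m n) (x : K n) :
  const_path (act f x) = act f (const_path x).
Proof. by apply: path_simplexP => l a t /=; rewrite act_comp. Qed.

Lemma path_end_const (K : sset) n e (x : K n) : path_end e (const_path x) = x.
Proof. exact: act_id. Qed.

Definition homotopic (K L : sset) (f g : smap K L) : Prop :=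
  exists h : smap K (path_space L), forall n (x : K n),
    path_end ord0 (h n x) = f n x /\ path_end ord_max (h n x) = g n x.

(* Equivalences of infinity-groupoids are homotopy equivalences; only used
   between Kan complexes. *)
Definition is_equiv (K L : sset) (f : smap K L) : Prop :=
  exists g : smap L K,
    homotopic (scomp g f) (sid K) /\ homotopic (scomp f g) (sid L).

Definition contractible (K : sset) : Prop := is_equiv (to_point K).

Definition is_empty (K : sset) : Prop := forall n, K n -> False.

Section HomotopyPullback.
Variables (B C D : sset) (f : smap B D) (g : smap C D).

Record hpb_simplex (n : nat) := HpbSimplex {
  hpb1 : B n;
  hpb2 : C n;
  hpb_path : path_space D n;
  hpb_start : path_end ord0 hpb_path = f n hpb1;
  hpb_end : path_end ord_max hpb_path = g n hpb2 }.

Lemma hpb_simplexP n (s t : hpb_simplex n) :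
  hpb1 s = hpb1 t -> hpb2 s = hpb2 t -> hpb_path s = hpb_path t -> s = t.
Proof.
case: s t => [x y p p0 p1] [x' y' p' p0' p1'] /= ex ey ep.
case: x' / ex p0' => p0'; case: y' / ey p1' => p1'.
case: p' / ep p0' p1' => p0' p1'.
by congr HpbSimplex; exact: Prop_irrelevance.
Qed.

Fact hpb_act_start m n (h : dmap m n) (s : hpb_simplex n) :
  path_end ord0 (act h (hpb_path s)) = f m (act h (hpb1 s)).
Proof. by rewrite path_end_act hpb_start sapp_act. Qed.

Fact hpb_act_end m n (h : dmap m n) (s : hpb_simplex n) :
  path_end ord_max (act h (hpb_path s)) = g m (act h (hpb2 s)).
Proof. by rewrite path_end_act hpb_end sapp_act. Qed.

Definition hpb_act m n (h : dmap m n) (s : hpb_simplex n) : hpb_simplex m :=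
  HpbSimplex (hpb_act_start h s) (hpb_act_end h s).

Fact hpb_act_id n (s : hpb_simplex n) : hpb_act (did n) s = s.
Proof. by apply: hpb_simplexP; exact: act_id. Qed.

Fact hpb_act_comp m n k (b : dmap n k) (a : dmap m n) (s : hpb_simplex k) :
  hpb_act (dcomp b a) s = hpb_act a (hpb_act b s).
Proof. by apply: hpb_simplexP; exact: act_comp. Qed.

Definition hpb : sset := SSet hpb_act_id hpb_act_comp.

Definition hpb_fst : smap hpb B :=
  @SMap hpb B (fun n s => hpb1 s) (fun _ _ _ _ => erefl).

Definition hpb_snd : smap hpb C :=
  @SMap hpb C (fun n s => hpb2 s) (fun _ _ _ _ => erefl).

Section Comparison.
Variables (A : sset) (p : smap A B) (q : smap A C).
Hypothesis fp_gq : forall n (x : A n), f n (p n x) = g n (q n x).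

Fact hpb_cmp_end n (x : A n) :
  path_end ord_max (const_path (f n (p n x))) = g n (q n x).
Proof. by rewrite path_end_const fp_gq. Qed.

Definition hpb_cmp_fun n (x : A n) : hpb n :=
  HpbSimplex (path_end_const ord0 (f n (p n x))) (hpb_cmp_end x).

Fact hpb_cmp_act m n (h : dmap m n) (x : A n) :
  hpb_cmp_fun (act h x) = act h (hpb_cmp_fun x).
Proof.
by apply: hpb_simplexP; rewrite /= ?sapp_act ?const_path_act.
Qed.

Definition hpb_cmp : smap A hpb := @SMap A hpb hpb_cmp_fun hpb_cmp_act.
End Comparison.
End HomotopyPullback.

Definition is_pullback (A B C D : sset)
    (p : smap A B) (q : smap A C) (f : smap B D) (g : smap C D) : Prop :=
  exists fp_gq : forall n (x : A n), f n (p n x) = g n (q n x),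
    is_equiv (hpb_cmp fp_gq).

Definition fibre (K L : sset) (f : smap K L) (y : L 0) : sset :=
  hpb f (pick_point y).

Definition is_mono (K L : sset) (f : smap K L) : Prop :=
  forall y : L 0, is_empty (fibre f y) \/ contractible (fibre f y).

(* The simplices of K all of whose vertices satisfy P; only used when P is
   invariant under paths, so that this is a union of components of K. *)
Section FullSub.
Variables (K : sset) (P : K 0 -> Prop).

Definition fullsub_simplex n := {x : K n | forall j, P (vertex j x)}.

Fact fullsub_act_subproof m n (h : dmap m n) (x : fullsub_simplex n) :
  forall j, P (vertex j (act h (sval x))).
Proof.
move=> j; rewrite /vertex -act_comp.
suff -> : dcomp h (dconst 0 j) = dconst 0 (h j) by exact: (svalP x).
apply: dmapP => i; rewrite dcompE; apply: ord_inj; rewrite dmkE.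
by congr (nat_of_ord (h _)); apply: ord_inj; rewrite dmkE.
Qed.

Definition fullsub_act m n (h : dmap m n) (x : fullsub_simplex n) :
  fullsub_simplex m := exist _ (act h (sval x)) (fullsub_act_subproof h x).

Lemma fullsub_simplexP n (x y : fullsub_simplex n) : sval x = sval y -> x = y.
Proof.
case: x y => [x Px] [y Py] /= e; case: y / e Py => Py.
by congr exist; exact: Prop_irrelevance.
Qed.

Fact fullsub_act_id n (x : fullsub_simplex n) : fullsub_act (did n) x = x.
Proof. by apply: fullsub_simplexP; exact: act_id. Qed.

Fact fullsub_act_comp m n k (g : dmap n k) (f : dmap m n)
  (x : fullsub_simplex k) :
  fullsub_act (dcomp g f) x = fullsub_act f (fullsub_act g x).
Proof. by apply: fullsub_simplexP; exact: act_comp. Qed.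

Definition fullsub : sset := SSet fullsub_act_id fullsub_act_comp.

Definition fullsub_incl : smap fullsub K :=
  @SMap fullsub K (fun n x => sval x) (fun _ _ _ _ => erefl).

Section Corestriction.
Variables (L : sset) (f : smap L K).
Hypothesis fP : forall n (x : L n) j, P (vertex j (f n x)).

Fact corestrict_act m n (h : dmap m n) (x : L n) :
  exist _ (f m (act h x)) (fP (act h x)) =
  act h (exist _ (f n x) (fP x) : fullsub n).
Proof. by apply: fullsub_simplexP; exact: sapp_act. Qed.

Definition corestrict : smap L fullsub :=
  @SMap L fullsub (fun n x => exist _ (f n x) (fP x)) corestrict_act.
End Corestriction.
End FullSub.

Definition is_path (K : sset) (p : K 1) (x y : K 0) : Prop :=
  act (face 0 1) p = x /\ act (face 0 0) p = y.

Definition connected (K : sset) (x y : K 0) : Prop :=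
  exists p : K 1, is_path p x y.

Definition path_homotopic (K : sset) (p q : K 1) : Prop :=
  exists w : K 2, [/\ act (face 1 2) w = p, act (face 1 1) w = q
    & act (face 1 0) w = const_simplex 1 (act (face 0 0) p)].

(* The elements of the n-th homotopy group, n >= 1, are represented by the
   n-simplices with constant boundary, up to homotopy relative to the boundary;
   here the dimension is n + 1. *)
Definition is_sphere (K : sset) (x : K 0) n (a : K n.+1) : Prop :=
  forall i, i <= n.+1 -> act (face n i) a = const_simplex n x.

Definition sphere_homotopic (K : sset) (x : K 0) n (a b : K n.+1) : Prop :=
  exists w : K n.+2,
    [/\ forall i, i <= n -> act (face n.+1 i) w = const_simplex n.+1 x,
        act (face n.+1 n.+1) w = a & act (face n.+1 n.+2) w = b].

Definition finite_upto (T : Type) (P : T -> Prop) (R : T -> T -> Prop) : Prop :=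
  exists (k : nat) (t : 'I_k -> T),
    forall x, P x -> exists i, P (t i) /\ R x (t i).

Definition loc_finite_space (K : sset) : Prop :=
  forall x : K 0,
    (forall n, finite_upto (@is_sphere K x n) (@sphere_homotopic K x n)) /\
    (exists N, forall n, N <= n -> forall a : K n.+1,
       is_sphere x a -> sphere_homotopic x a (const_simplex n.+1 x)).

Definition finite_space (K : sset) : Prop :=
  loc_finite_space K /\ finite_upto (fun _ : K 0 => True) (@connected K).

Definition finite_map (K L : sset) (f : smap K L) : Prop :=
  forall y : L 0, finite_space (fibre f y).

(* Contravariant functors. *)
Record diagram (C : category) := Diagram {
  dob :> ob C -> sset;
  dob_kan : forall a, is_kan (dob a);
  dmor : forall a b, hom a b -> smap (dob b) (dob a);
  dmor_id : forall a n (x : dob a n), dmor (idm a) n x = x;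
  dmor_comp : forall a b c (g : hom b c) (f : hom a b) n (x : dob c n),
    dmor (comp g f) n x = dmor f n (dmor g n x) }.

Arguments dob_kan {C} d a.

Record transformation (C : category) (X Y : diagram C) := Transformation {
  tcomp :> forall a, smap (X a) (Y a);
  tnat : forall a b (f : hom a b) n (x : X b n),
    tcomp a n (dmor X f n x) = dmor Y f n (tcomp b n x) }.

(* Equivalence of the represented infinity-functors: a span of levelwise
   equivalences, as strict transformations only present all maps of
   infinity-functors after replacing the source. *)
Definition equivalent (C : category) (X Y : diagram C) : Prop :=
  exists (Z : diagram C) (s : transformation Z X) (t : transformation Z Y),
    forall a, is_equiv (s a) /\ is_equiv (t a).

Section Precomposition.
Variables (C D : category) (F : functor C D) (A : diagram D).

Fact precomp_id a n (x : A (F a) n) : dmor A (fmor F (idm a)) n x = x.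
Proof. by rewrite fmor_id dmor_id. Qed.

Fact precomp_comp a b c (g : hom b c) (f : hom a b) n (x : A (F c) n) :
  dmor A (fmor F (comp g f)) n x =
  dmor A (fmor F f) n (dmor A (fmor F g) n x).
Proof. by rewrite fmor_comp dmor_comp. Qed.

Definition precomp : diagram C :=
  @Diagram C (fun a => A (F a)) (fun a => dob_kan A (F a))
    (fun a b f => dmor A (fmor F f)) precomp_id precomp_comp.
End Precomposition.

Definition simplicial_space := diagram Delta.

Definition op (X : simplicial_space) m n (f : dmap m n) : smap (X n) (X m) :=
  @dmor Delta X m n f.

(* The face operator d_i, for i <= n + 1. *)
Definition d (X : simplicial_space) n i : smap (X n.+1) (X n) := op X (face n i).

Definition s0 (X : simplicial_space) : smap (X 0) (X 1) := op X (degen0 0).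

Definition decomposition_space (X : simplicial_space) : Prop :=
  forall (m n k l : nat) (a : dmap m n) (i : dmap m k)
         (j : dmap n l) (b : dmap k l),
    active a -> inert i -> @is_pushout Delta m n k l a i j b ->
    is_pullback (op X j) (op X b) (op X a) (op X i).

Definition complete (X : simplicial_space) : Prop := is_mono (s0 X).

Definition degenerate (X : simplicial_space) (a : X 1 0) : Prop :=
  exists x : X 0 0, connected (s0 X 0 x) a.

Definition edges_nondegenerate (X : simplicial_space) r (x : X r 0) : Prop :=
  forall i : 'I_r, ~ degenerate (op X (principal_edge i) 0 x).

Definition nondegenerate (X : simplicial_space) r : sset :=
  fullsub (@edges_nondegenerate X r).

Definition nondegenerate_long_edge (X : simplicial_space) r :
    smap (nondegenerate X r) (X 1) :=
  scomp (op X (long_edge r)) (fullsub_incl (@edges_nondegenerate X r)).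

Definition tight (X : simplicial_space) : Prop :=
  forall a : X 1 0, exists N, forall r, N <= r ->
    is_empty (fibre (nondegenerate_long_edge X r) a).

Definition loc_finite (X : simplicial_space) : Prop :=
  [/\ loc_finite_space (X 1), finite_map (s0 X) & finite_map (d X 1 1)].

Definition mobius (X : simplicial_space) : Prop :=
  [/\ decomposition_space X, complete X, loc_finite X & tight X].

(* The homotopy limit X_1 x_{X_0} ... x_{X_0} X_1 with n + 1 factors: families
   of n + 1 edges with, for each i < n, a path from the target of the i-th edge
   to the source of the (i + 1)-st one.  For i : 'I_n, lift ord_max i and
   lift ord0 i are the elements of 'I_n.+1 with values i and i + 1. *)
Section Segal.
Variables (X : simplicial_space) (n : nat).

Record spine_simplex (m : nat) := SpineSimplex {
  sp_edge : 'I_n.+1 -> X 1 m;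
  sp_path : 'I_n -> path_space (X 0) m;
  sp_start : forall i : 'I_n,
    path_end ord0 (sp_path i) = d X 0 0 m (sp_edge (lift ord_max i));
  sp_end : forall i : 'I_n,
    path_end ord_max (sp_path i) = d X 0 1 m (sp_edge (lift ord0 i)) }.

Lemma spine_simplexP m (s t : spine_simplex m) :
  sp_edge s =1 sp_edge t -> sp_path s =1 sp_path t -> s = t.
Proof.
case: s t => [x p p0 p1] [x' p' p0' p1'] /= /funext ex /funext ep.
case: x' / ex p0' p1' => p0' p1'; case: p' / ep p0' p1' => p0' p1'.
by congr SpineSimplex; exact: Prop_irrelevance.
Qed.

Fact spine_act_start k m (h : dmap k m) (s : spine_simplex m) (i : 'I_n) :
  path_end ord0 (act h (sp_path s i)) =
  d X 0 0 k (act h (sp_edge s (lift ord_max i))).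
Proof. by rewrite path_end_act sp_start sapp_act. Qed.

Fact spine_act_end k m (h : dmap k m) (s : spine_simplex m) (i : 'I_n) :
  path_end ord_max (act h (sp_path s i)) =
  d X 0 1 k (act h (sp_edge s (lift ord0 i))).
Proof. by rewrite path_end_act sp_end sapp_act. Qed.

Definition spine_act k m (h : dmap k m) (s : spine_simplex m) :
    spine_simplex k :=
  @SpineSimplex k (fun i => act h (sp_edge s i)) (fun i => act h (sp_path s i))
    (spine_act_start h s) (spine_act_end h s).

Fact spine_act_id m (s : spine_simplex m) : spine_act (did m) s = s.
Proof. by apply: spine_simplexP => i; exact: act_id. Qed.

Fact spine_act_comp k l m (g : dmap l m) (f : dmap k l) (s : spine_simplex m) :
  spine_act (dcomp g f) s = spine_act f (spine_act g s).
Proof. by apply: spine_simplexP => i; exact: act_comp. Qed.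

Definition spine : sset := SSet spine_act_id spine_act_comp.

Definition edge (i : 'I_n.+1) : smap (X n.+1) (X 1) := op X (principal_edge i).

Fact spine_match (i : 'I_n) :
  dcomp (principal_edge (lift ord_max i)) (face 0 0) =
  dcomp (principal_edge (lift ord0 i)) (face 0 1).
Proof.
apply: dmapP => j; apply: ord_inj; rewrite !dcompE !dmkE.
by rewrite (ord1 j) lift_max lift0 addn0; exact: addn1.
Qed.

Fact spine_cmp_start m (x : X n.+1 m) (i : 'I_n) :
  path_end ord0 (const_path (d X 0 0 m (edge (lift ord_max i) m x))) =
  d X 0 0 m (edge (lift ord_max i) m x).
Proof. exact: path_end_const. Qed.

Fact spine_cmp_end m (x : X n.+1 m) (i : 'I_n) :
  path_end ord_max (const_path (d X 0 0 m (edge (lift ord_max i) m x))) =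
  d X 0 1 m (edge (lift ord0 i) m x).
Proof.
rewrite path_end_const /d /edge /op.
by rewrite -!(@dmor_comp Delta) /= spine_match.
Qed.

Definition spine_cmp_fun m (x : X n.+1 m) : spine m :=
  @SpineSimplex m (fun i => edge i m x)
    (fun i => const_path (d X 0 0 m (edge (lift ord_max i) m x)))
    (spine_cmp_start x) (spine_cmp_end x).

Fact spine_cmp_act k m (h : dmap k m) (x : X n.+1 m) :
  spine_cmp_fun (act h x) = act h (spine_cmp_fun x).
Proof.
by apply: spine_simplexP => i; rewrite /= !sapp_act ?const_path_act.
Qed.

Definition spine_cmp : smap (X n.+1) spine :=
  @SMap (X n.+1) spine spine_cmp_fun spine_cmp_act.
End Segal.

Definition segal (X : simplicial_space) : Prop :=
  forall n, is_equiv (spine_cmp X n).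

(* For an arrow f : x -> y, has_left_inverse says that some g : y -> x satisfies
   g f ~ id_x in the mapping space from x to x, and has_right_inverse that some
   h : y -> x satisfies f h ~ id_y.  The composite is exhibited by a 2-simplex
   t whose relevant short edge is identified with f along p, and whose long
   edge is identified with an identity along q; g is the other short edge of t,
   its two ends being identified with y and x along p and q.  The condition on
   p and q says that q is a path in the mapping space, i.e. that it also
   respects the remaining end of the long edge. *)
Definition has_left_inverse (X : simplicial_space) (f : X 1 0) : Prop :=
  exists (t : X 2 0) (p q : X 1 1),
    [/\ is_path p (d X 1 2 0 t) f,
        is_path q (d X 1 1 0 t) (s0 X 0 (d X 0 1 0 f))
      & path_homotopic (d X 0 1 1 p) (d X 0 1 1 q)].

Definition has_right_inverse (X : simplicial_space) (f : X 1 0) : Prop :=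
  exists (t : X 2 0) (p q : X 1 1),
    [/\ is_path p (d X 1 0 0 t) f,
        is_path q (d X 1 1 0 t) (s0 X 0 (d X 0 0 0 f))
      & path_homotopic (d X 0 0 1 p) (d X 0 0 1 q)].

Definition is_equivalence (X : simplicial_space) (f : X 1 0) : Prop :=
  has_left_inverse f /\ has_right_inverse f.

Definition equivalences (X : simplicial_space) : sset :=
  fullsub (@is_equivalence X).

Definition rezk_complete (X : simplicial_space) : Prop :=
  exists s0_equivalence :
      forall n (x : X 0 n) j, is_equivalence (vertex j (s0 X n x)),
    is_equiv (corestrict s0_equivalence).

Definition rezk_complete_segal_space (X : simplicial_space) : Prop :=
  segal X /\ rezk_complete X.

Definition xi_op (A : diagram Xi) m n (f : xmap m n) : smap (A n) (A m) :=
  @dmor Xi A m n f.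

(* As the object n of Xi is written [n - 1] in the usual indexing, A_n, for
   n >= 0, is A n.+1. *)
Definition flanked (A : diagram Xi) : Prop :=
  forall n : nat,
    is_pullback (xi_op A (xdtop n)) (xi_op A (xsbot n.+1))
                (xi_op A (xsbot n)) (xi_op A (xdtop n.+1)) /\
    is_pullback (xi_op A (xdbot n)) (xi_op A (xstop n.+1))
                (xi_op A (xstop n)) (xi_op A (xdbot n.+1)).

Definition i_star (A : diagram Xi) : simplicial_space := precomp i_functor A.

Definition flanked_decomposition_space (A : diagram Xi) : Prop :=
  flanked A /\ decomposition_space (i_star A).

(* The degeneracy maps are those induced by the surjections [n] -> [n - 1],
   which identify two neighbours, possibly the bottom or the top element. *)
Definition complete_flanked (A : diagram Xi) : Prop :=
  forall n (s : xmap n.+1 n), xsurjective s -> is_mono (xi_op A s).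

Definition reduced (A : diagram Xi) : Prop := contractible (A 0).

Definition algebraic_interval (A : diagram Xi) : Prop :=
  [/\ flanked_decomposition_space A, complete_flanked A & reduced A].

Definition interval (X : simplicial_space) : Prop :=
  exists A : diagram Xi, algebraic_interval A /\ equivalent X (i_star A).

Definition mobius_interval (X : simplicial_space) : Prop :=
  interval X /\ mobius X.

(* Main.v *)
(* Kan complexes enter through the homotopy extension property, which follows
   from prism filling, passes to homotopy pullbacks, and allows one to treat
   trivial fibrations, homotopy equivalences and homotopy pullbacks with
   explicit square fillings.

   Segal: in an interval the simplices X_n are identified, by the flanking
   squares, with the (n+1)-simplices of X whose initial vertex is the bottom.
   Hence the square X_{n+1} -> X_1 over X_n -> X_0 (last edge over last vertex),
   pasted with a flanking square, equals another flanking square pasted with the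
   decomposition square X_{n+2} = X_{n+1} x_{X_1} X_2 along the long edge; as the
   flanking squares are pullbacks, so is the first one.

   Rezk: if t is a 2-simplex with degenerate long edge, gluing copies of t and
   of the degenerate simplex on its first edge produces arbitrarily long simplices
   with a fixed long edge, so by tightness one of the short edges of t is
   degenerate, and then so is the first one.  Hence every equivalence is
   degenerate, and s_0, being a monomorphism, identifies X_0 with the
   equivalences. *)

From HB Require Import structures.
From mathcomp Require Import all_boot.
From mathcomp Require Import boolp classical_sets.
From mathcomp Require Import zify.
Require Import Defs.

Set Implicit Arguments.
Unset Strict Implicit.
Unset Printing Implicit Defensive.

(** * Partial maps and lifting *)

(** Horn filling is awkward to carry through the path spaces of [hpb]. Lifting of [pend] against all
    monomorphisms is not: the product of a monomorphism with the interval and its ends poses a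
    lifting problem of the same kind ([lift_cyl]), so squares with prescribed sides can be filled
    relative to any part already given. The Kan condition therefore enters through [kan_fills]
    alone. Lifting problems are posed with graphs of partial maps, so that boundaries, horns and
    unions of prisms need not be built as simplicial sets.

    The obstacle on the side of decomposition spaces is that they do not glue simplices at a vertex:
    a triangle can only be glued onto the long edge of a simplex. In the Segal half the bottom
    element removes this obstacle, since after prepending it the last vertex of a simplex becomes
    its long edge. In the Rezk half each triangle has to start with the current long edge: [t] turns
    the long edge [f] into an identity, and the degenerate triangle turns that identity back into
    [f]. *)

Lemma smapP (K L : sset) (f g : smap K L) : (forall n x, f n x = g n x) -> f = g.
Proof.
case: f g => [f fP] [g gP] /= e.
have {}e : f = g by do 2 apply: functional_extensionality_dep => ?; apply: e.
by case: g / e gP => gP; congr SMap; exact: Prop_irrelevance.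
Qed.

Lemma dmap0P m (f g : dmap m 0) : f = g.
Proof. by apply: dmapP => i; rewrite [LHS]ord1 [RHS]ord1. Qed.

Lemma const_simplex0 (K : sset) (x : K 0) : const_simplex 0 x = x.
Proof. by rewrite -[RHS]act_id; congr act; exact: dmap0P. Qed.

Definition onto m n (a : dmap m n) : Prop := forall j, exists i, a i = j.

Lemma dmap_of_fun m n (g : 'I_m.+1 -> 'I_n.+1) :
  (forall i j : 'I_m.+1, i <= j -> g i <= g j) ->
  exists s : dmap m n, forall i, s i = g i.
Proof.
move=> gP.
have P : [forall i : 'I_m.+1, forall j : 'I_m.+1,
           (i <= j) ==> ([ffun i => g i] i <= [ffun i => g i] j)].
  by apply/forallP => i; apply/forallP => j; apply/implyP => ?; rewrite !ffunE gP.
by exists (DMap P) => i /=; rewrite ffunE.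
Qed.

(** The freedom to send [a i] back to [i] is what tells two surjections apart by their sections, as
    in the Eilenberg-Zilber lemma; see [skeletal_step]. *)
Lemma onto_section m n (a : dmap m n) (i : 'I_m.+1) : onto a ->
  exists s : dmap n m, dcomp a s = did n /\ s (a i) = i.
Proof.
move=> /choice [g gP].
have [|s sP] := @dmap_of_fun n m (fun j => if j == a i then i else g j).
  have aP j : a (if j == a i then i else g j) = j by case: eqP => [->|_].
  move=> j j' le_j; rewrite leqNgt; apply/negP => lt_j.
  have le_j' : j' <= j by rewrite -(aP j) -(aP j') dmap_le // ltnW.
  have e : j = j' by apply/ord_inj/eqP; rewrite eqn_leq le_j.
  by rewrite e ltnn in lt_j.
exists s; split; last by rewrite sP eqxx.
by apply: dmapP => j; rewrite dcompE didE sP; case: eqP => [->|].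
Qed.

Lemma dmap_inj_ge n (f : dmap n n) : injective f -> forall i : 'I_n.+1, i <= f i.
Proof.
move=> f_inj [i lt_i] /=; elim: i lt_i => // i IH lt_i.
apply: leq_ltn_trans (IH (ltnW lt_i)) _.
rewrite ltn_neqAle dmap_le ?leqnSn // andbT.
by apply/eqP => /ord_inj/f_inj/(congr1 (@nat_of_ord _)) /= /n_Sn.
Qed.

Lemma onto_endo n (c : dmap n n) : onto c -> c = did n.
Proof.
move=> c_onto; have [s [cs _]] := onto_section ord0 c_onto.
have csK : cancel s c by move=> j; rewrite -dcompE cs didE.
have scK : cancel c s by apply/(bij_can_sym (injF_bij (can_inj csK))).
apply: dmapP => j; rewrite didE; apply/ord_inj/eqP; rewrite eqn_leq.
rewrite (dmap_inj_ge (can_inj scK)) andbT.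
by rewrite -{2}(csK j) dmap_le // (dmap_inj_ge (can_inj csK)).
Qed.

Lemma dcomp_onto m n k (g : dmap n k) (f : dmap m n) : onto (dcomp g f) -> onto g.
Proof. by move=> gf j; have [i <-] := gf j; exists (f i); rewrite dcompE. Qed.

Lemma dmap_face m n (a : dmap m n.+1) (j : 'I_n.+2) : (forall i, a i != j) ->
  exists b : dmap m n, a = dcomp (face n j) b.
Proof.
move=> aj.
have aj' i : (a i : nat) != j by apply: contra (aj i) => /eqP/ord_inj->.
have lt_b i : unbump j (a i) < n.+1.
  rewrite /unbump; have := ltn_ord (a i); have := ltn_ord j; have := aj' i; lia.
have [|b bP] := @dmap_of_fun m n (fun i => Ordinal (lt_b i)).
  move=> p q /(dmap_le a) /=; rewrite /unbump; have := aj' p; have := aj' q; lia.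
exists b; apply: dmapP => i; apply: ord_inj; rewrite dcompE dmkE bP /= unbumpK //.
exact: aj'.
Qed.

Lemma not_onto m n (a : dmap m n) : ~ onto a -> exists j, forall i, a i != j.
Proof.
move=> /existsNP[j aj]; exists j => i; apply/eqP => ai; by apply: aj; exists i.
Qed.

Lemma not_onto_face m n (a : dmap m n.+1) : ~ onto a ->
  exists (j : 'I_n.+2) (b : dmap m n), a = dcomp (face n j) b.
Proof. by move=> /not_onto[j /dmap_face[b ab]]; exists j, b. Qed.

Lemma onto0 m (a : dmap m 0) : onto a.
Proof. by move=> j; exists ord0; rewrite (ord1 j) [LHS]ord1. Qed.

(* The graphs of partial maps: gluing partial maps is then disjunction. *)
Definition srel (V K : sset) := forall n, V n -> K n -> Prop.

Section PartialMaps.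
Variables V K : sset.
Implicit Type R : srel V K.

Definition partial_map R : Prop :=
  (forall m n (f : dmap m n) x y, R n x y -> R m (act f x) (act f y)) /\
  (forall n x y y', R n x y -> R n x y' -> y = y').

Definition dom R n (x : V n) : Prop := exists y, R n x y.

Definition attach R N (v : V N) (y : K N) m (x : V m) (z : K m) : Prop :=
  R m x z \/ exists u : dmap m N, x = act u v /\ z = act u y.

(** Values can clash in two ways: an old one against a new one, or two new ones at a simplex that is
    in two ways an image of [v]. The second clash matters only outside the old domain, where the
    operator must be unique. *)
Lemma attach_partial R N (v : V N) (y : K N) : partial_map R ->
  (forall m (u : dmap m N), dom R (act u v) -> R m (act u v) (act u y)) ->
  (forall m (u u' : dmap m N), act u v = act u' v -> ~ dom R (act u v) -> u = u') ->
  partial_map (attach R v y).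
Proof.
move=> [Rcl Rfun] old new; split=> [m n f x z|n x z z'].
  case=> [/Rcl?|[u [-> ->]]]; [by left|right].
  by exists (dcomp u f); rewrite !act_comp.
case=> [Rz|[u [xu ->]]] [Rz'|[u' [xu' ->]]].
- exact: Rfun Rz Rz'.
- by apply: Rfun (Rz) _; rewrite xu'; apply: old; rewrite -xu'; exists z.
- by apply: Rfun (Rz'); rewrite xu; apply: old; rewrite -xu; exists z'.
- case: (pselect (dom R x)) => [xD|xD].
    by apply: (Rfun n x); [rewrite xu|rewrite xu']; apply: old; rewrite -?xu -?xu'.
  by congr act; apply: new; rewrite -xu.
Qed.

Lemma total_partial R : partial_map R -> (forall n x, @dom R n x) ->
  exists H : smap V K, forall n x, R n x (H n x).
Proof.
move=> [Rcl Rfun] Rtot.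
pose H n x := projT1 (cid (@Rtot n x)).
have HP n x : R n x (H n x) by rewrite /H; case: cid.
have Hact m n (f : dmap m n) x : H m (act f x) = act f (H n x).
  by apply: Rfun (HP _ _) (Rcl _ _ _ _ _ (HP _ _)).
by exists (SMap Hact).
Qed.
End PartialMaps.

Lemma dom_act (V K : sset) (R : srel V K) : partial_map R ->
  forall m n (f : dmap m n) x, dom R x -> dom R (act f x).
Proof. by move=> [Rcl _] m n f x [y /(Rcl _ _ f)]; exists (act f y). Qed.

Lemma dom_act_onto (V K : sset) (R : srel V K) : partial_map R ->
  forall m n (f : dmap m n) x, onto f -> dom R (act f x) -> dom R x.
Proof.
move=> Rp m n f x /(onto_section ord0)[s [fs _]] /(dom_act Rp s).
by rewrite -act_comp fs act_id.
Qed.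

(* p is a trivial fibration, in the form of lifting against all monomorphisms. *)
Definition lifts (E B : sset) (p : smap E B) : Prop :=
  forall (V : sset) (R : srel V E) (G : smap V B),
    partial_map R -> (forall n x y, R n x y -> p n y = G n x) ->
    exists H : smap V E,
      (forall n x y, R n x y -> H n x = y) /\ forall n x, p n (H n x) = G n x.

(* Lifting against the boundary inclusions. *)
Definition fills (E B : sset) (p : smap E B) : Prop :=
  forall n (b : B n) (F : forall m (a : dmap m n), ~ onto a -> E m),
    (forall m (a : dmap m n) (na : ~ onto a) k (f : dmap k m) (naf : ~ onto (dcomp a f)),
       F k (dcomp a f) naf = act f (F m a na)) ->
    (forall m (a : dmap m n) na, p m (F m a na) = act a b) ->
    exists e : E n, p n e = b /\ forall m a na, act a e = F m a na.

Section Skeletal.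
Variables (E B : sset) (p : smap E B) (V : sset) (G : smap V B).
Variable R0 : srel V E.
Hypothesis pF : fills p.

Let good (R : srel V E) : Prop :=
  [/\ partial_map R, (forall n x y, R n x y -> p n y = G n x)
    & forall n x y, R0 x y -> R n x y].

(** A simplex of least dimension outside the domain has its whole boundary inside, so [pF] provides
    a value for it, and attaching this value contradicts maximality. *)
Lemma skeletal_step R : good R ->
  (forall R', good R' -> (forall n x y, R n x y -> R' n x y) ->
     forall n x y, R' n x y -> R n x y) ->
  forall n x, @dom _ _ R n x.
Proof.
move=> [Rp RG R0R] Rmax.
elim/ltn_ind => n IH x; apply: contrapT => xD.
have nD m (a : dmap m n) : ~ onto a -> dom R (act a x).
  case: n IH x xD a => [|n] IH x xD a na; first by case: na; exact: onto0.
  have [j [b ->]] := not_onto_face na.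
  by rewrite act_comp; apply: dom_act => //; exact: IH.
have [Rcl Rfun] := Rp.
pose F m a (na : ~ onto a) := projT1 (cid (nD m a na)).
have FP m a na : R m (act a x) (F m a na) by rewrite /F; case: cid.
have [|m a na|e [pe eF]] := pF (b := G n x) (F := F).
- move=> m a na k f naf; apply: Rfun (FP _ _ _) _.
  by rewrite act_comp; exact: Rcl.
- by rewrite (RG _ _ _ (FP _ _ _)) sapp_act.
have Dn m (a : dmap m n) : dom R (act a x) -> ~ onto a.
  by move=> aD a_onto; apply: xD; exact: dom_act_onto aD.
have attP : partial_map (attach R x e).
  apply: attach_partial => // [m u uD|m u u' uu' uD].
    by rewrite (eF _ _ (Dn _ _ uD)).
  have oo k (v : dmap k n) : ~ dom R (act v x) -> onto v.
    by move=> vD; apply: contrapT => /nD.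
  (* Eilenberg-Zilber: for a section [s] of [u], the operator [dcomp u' s] fixes [x], hence is onto,
     hence the identity. Taking [s] through [i] gives the equality of [u] and [u'] at [i]. *)
  have u_onto := oo _ _ uD; have u'_onto : onto u' by apply: oo; rewrite -uu'.
  apply: dmapP => i; have [s [us su]] := onto_section i u_onto.
  have xs : x = act (dcomp u' s) x by rewrite act_comp -uu' -act_comp us act_id.
  have /onto_endo/(congr1 (fun f : dmap n n => f (u i))) : onto (dcomp u' s).
    by apply: oo; rewrite -xs.
  by rewrite dcompE didE su.
apply: xD; exists e; apply: (Rmax (attach R x e)).
- split=> // [m y z|m y z /R0R]; last by left.
  by case=> [/RG//|[u [-> ->]]]; rewrite !sapp_act pe.
- by left.
- by right; exists (did n); rewrite !act_id.
Qed.

Lemma skeletal_lift : good R0 -> exists H : smap V E,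
  (forall n x y, R0 x y -> H n x = y) /\ forall n x, p n (H n x) = G n x.
Proof.
move=> R0good.
pose T := {R | good R}.
pose le (s t : T) := `[< forall n x y, sval s n x y -> sval t n x y >].
have [|||A Atot|R Rmax] := @Zorn T le.
- by move=> t; apply/asboolP.
- move=> r s t /asboolP rs /asboolP st; apply/asboolP => n x y /rs; exact: st.
- move=> [s sP] [t tP] /asboolP /= st /asboolP /= ts.
  have e : s = t.
    do 3 apply: functional_extensionality_dep => ?.
    by apply/propext; split; [exact: st|exact: ts].
  by case: t / e tP {st ts} => tP; congr exist; exact: Prop_irrelevance.
(* [R0] is included in the union so that the empty chain is bounded too. *)
- pose S n x y := @R0 n x y \/ exists2 R : T, A R & sval R n x y.
  have Sgood : good S.
    split.
    + split=> [m n f x y|n x y y'].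
        case=> [Rxy|[R RA Rxy]]; [left|right; exists R => //].
          by have [[Rcl _] _ _] := R0good; exact: Rcl.
        by have [[Rcl _] _ _] := svalP R; exact: Rcl.
      case=> [Rxy|[R RA Rxy]] [Rxy'|[R' RA' Rxy']].
      * by have [[_ Rfun] _ _] := R0good; exact: Rfun Rxy Rxy'.
      * by have [[_ Rfun] _ R0R] := svalP R'; exact: Rfun (R0R _ _ _ Rxy) Rxy'.
      * by have [[_ Rfun] _ R0R] := svalP R; exact: Rfun Rxy (R0R _ _ _ Rxy').
      * have [/asboolP|/asboolP] := Atot _ _ RA RA' => le_R.
          by have [[_ Rfun] _ _] := svalP R'; exact: Rfun (le_R _ _ _ Rxy) Rxy'.
        by have [[_ Rfun] _ _] := svalP R; exact: Rfun Rxy (le_R _ _ _ Rxy').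
    + by move=> n x y [|[R _]]; [have [_ RG _] := R0good|have [_ RG _] := svalP R];
        exact: RG.
    + by left.
  by exists (exist _ S Sgood) => s As; apply/asboolP => n x y; right; exists s.
have [||H HP] := @total_partial _ _ (sval R).
- by have [] := svalP R.
- apply: skeletal_step; first exact: svalP.
  move=> R' R'good RR' n x y; have := Rmax (exist _ R' R'good).
  by move=> <- //; apply/asboolP.
have [[_ Rfun] RG R0R] := svalP R.
exists H; split=> n x => [y /R0R Rxy|]; first exact: Rfun (HP _ _) Rxy.
exact: RG.
Qed.
End Skeletal.

Lemma fills_lifts E B (p : smap E B) : fills p -> lifts p.
Proof. by move=> pF V R G Rp RG; apply: skeletal_lift. Qed.

(** * Prism filling *)

Definition simplex (n : nat) : sset :=
  @SSet (fun m => dmap m n) (fun _ _ f a => dcomp a f) (fun m a => dcomp_idr a)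
        (fun _ _ _ g f a => dcompA a g f).

Section Product.
Variables V W : sset.

Fact sprod_act_id n (x : V n * W n) : (act (did n) x.1, act (did n) x.2) = x.
Proof. by rewrite !act_id -surjective_pairing. Qed.

Fact sprod_act_comp m n k (g : dmap n k) (f : dmap m n) (x : V k * W k) :
  (act (dcomp g f) x.1, act (dcomp g f) x.2) =
  (act f (act g x.1), act f (act g x.2)).
Proof. by rewrite !act_comp. Qed.

Definition sprod : sset :=
  @SSet (fun n => (V n * W n)%type) (fun _ _ f x => (act f x.1, act f x.2))
        sprod_act_id sprod_act_comp.
End Product.

Definition pend (K : sset) (e : 'I_2) : smap (path_space K) K :=
  @SMap _ _ (fun n p => @path_end K n e p) (fun m n f p => path_end_act f e p).

(* The homotopy extension property, at both ends of the interval. *)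
Definition hep (K : sset) : Prop := forall e, lifts (pend K e).

Lemma pfun_did (K : sset) n (p : path_space K n) m (a : dmap m n) t :
  pfun (act a p) (did m) t = pfun p a t.
Proof. by rewrite /= dcomp_idr. Qed.

Lemma pfunE (K : sset) n (p : path_space K n) m (a : dmap m n) e :
  pfun p a (dconst m e) = act a (path_end e p).
Proof. by rewrite -path_end_act /path_end pfun_did. Qed.

Lemma dconstP m n (t : dmap m n) (e : 'I_n.+1) :
  (forall p, t p = e :> nat) -> t = dconst m e.
Proof. by move=> tE; apply: dmapP => p; apply: ord_inj; rewrite tE dmkE. Qed.

Section Prism.
Variable n : nat.

Fact sigma1_bound j p : j <= n -> p <= n.+1 -> (if p <= j then p else p.-1) <= n.
Proof. by case: ifP; lia. Qed.

Fact sigma1_mono j p q : p <= q -> q <= n.+1 ->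
  (if p <= j then p else p.-1) <= (if q <= j then q else q.-1).
Proof. by do 2 case: ifP; lia. Qed.

Definition sigma1 (j : 'I_n.+1) : dmap n.+1 n :=
  dmk (fun p => @sigma1_bound j p (leq_ord j)) (@sigma1_mono j).

Fact sigma2_mono (j : nat) p q : p <= q -> q <= n.+1 -> (j < p) <= (j < q).
Proof. by lia. Qed.

Definition sigma2 (j : 'I_n.+1) : dmap n.+1 1 :=
  dmk (fun p _ => leq_b1 (j < p)) (@sigma2_mono j).

(* The maximal simplex (0,0), ..., (j,0), (j,1), ..., (n,1) of the prism. *)
Definition sigma j : sprod (simplex n) (simplex 1) n.+1 := (sigma1 j, sigma2 j).

Definition through (i : nat) m (a : dmap m n) (t : dmap m 1) : Prop :=
  forall p, if t p == 0 :> nat then a p <= i else i <= a p.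

(** The point (q, e) of the prism, if it lies on [sigma j], is its vertex number q + e; hence [u]
    has to be the sum of [a] and [t]. *)
Lemma throughP (j : 'I_n.+1) m (a : dmap m n) (t : dmap m 1) :
  through j a t <-> exists u, (a, t) = act u (sigma j).
Proof.
split=> [at_j|[u [-> ->]] p]; last by rewrite !dcompE !dmkE; do !case: ifP; lia.
have lt_u p : a p + t p < n.+2.
  by have := ltn_ord (a p); have := ltn_ord (t p); lia.
have [|u uP] := @dmap_of_fun m n.+1 (fun p => Ordinal (lt_u p)).
  by move=> p q le_pq; have := dmap_le a le_pq; have := dmap_le t le_pq => /=; lia.
exists u; congr pair; apply: dmapP => p; apply: ord_inj; rewrite dcompE dmkE uP /=.
  by have := at_j p; have := ltn_ord (t p); do !case: ifP; lia.
by have := at_j p; have := ltn_ord (t p); do !case: ifP; lia.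
Qed.

Lemma sigma_inj j m (u u' : dmap m n.+1) :
  act u (sigma j) = act u' (sigma j) -> u = u'.
Proof.
move=> e; apply: dmapP => p; apply: ord_inj.
have := congr1 (fun x => (x.1 : dmap m n) p : nat) e.
have := congr1 (fun x => (x.2 : dmap m 1) p : nat) e.
by rewrite /= !ffunE /=; do !case: ifP; lia.
Qed.

(* The prisms already filled after c steps: the last c ones when the path is
   given at its start, the first c ones when it is given at its end. *)
Definition filled (e : 'I_2) c i : bool :=
  if e == 0 :> nat then n < c + i else i < c.

Definition reached (e : 'I_2) c m (x : sprod (simplex n) (simplex 1) m) : Prop :=
  [\/ ~ onto x.1, forall p, x.2 p = e :> nat
    | exists2 i, i <= n & filled e c i /\ through i x.1 x.2].

Section Step.
Variables (e : 'I_2) (c : nat).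
Hypothesis le_cn : c <= n.

(* The next prism simplex, and the vertex of the horn along which it is attached. *)
Definition prism_index : nat := if e == 0 :> nat then n - c else c.
Definition prism_hole : nat := if e == 0 :> nat then prism_index else prism_index.+1.

Fact prism_index_lt : prism_index < n.+1.
Proof. by move: le_cn; rewrite /prism_index; do !case: ifP; lia. Qed.

Fact prism_hole_lt : prism_hole < n.+2.
Proof. by move: le_cn; rewrite /prism_hole /prism_index; do !case: ifP; lia. Qed.

Let j := Ordinal prism_index_lt.
Let k := Ordinal prism_hole_lt.

(** Faces other than [j] and [j.+1] project to a proper face of the base simplex. Of the two inner
    ones, one is the hole [k]; the other is shared with the prism simplex filled just before or,
    when [c] is 0, is the given end of the prism. *)
Lemma reached_face (i : 'I_n.+2) : i != k -> reached e c (act (face n i) (sigma j)).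
Proof.
move=> ik0; have {ik0} ik: (i : nat) <> k by move=> /ord_inj ik; rewrite ik eqxx in ik0.
have := ltn_ord i; have := ltn_ord e; move: ik; rewrite /= /prism_hole /=.
have [ij|ij] := boolP ((i == j :> nat) || (i == j.+1 :> nat)); last first.
  move=> _ _ _; constructor 1 => ai.
  have lt_v : (if i < j then i : nat else i.-1) < n.+1.
    by have := ltn_ord i; have := ltn_ord j; do !case: ifP; lia.
  have [p /(congr1 (@nat_of_ord _))] := ai (Ordinal lt_v).
  rewrite /= !ffunE /= /bump; move: ij; have := ltn_ord p; have := ltn_ord i.
  by rewrite /=; do !case: ifP; lia.
rewrite /prism_index => ik e2 i2.
case: (posnP c) => [c0|c_gt0].
  constructor 2 => p; rewrite /= !ffunE /= /bump.
  move: ij ik; rewrite /= /prism_index c0; have := ltn_ord p.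
  by do !case: ifP; lia.
constructor 3; exists (if e == 0 :> nat then prism_index.+1 else prism_index.-1).
  by rewrite /prism_index; do !case: ifP; lia.
split; first by rewrite /filled /prism_index; do !case: ifP; lia.
move=> p; rewrite /= !ffunE /= /bump.
move: ij ik; rewrite /= /prism_index; have := ltn_ord p.
by do !case: ifP; lia.
Qed.

(** Together with [reached_face]: the next prism simplex meets what has been reached exactly in its
    horn at [k], so a horn filler is compatible with all earlier values. *)
Lemma reached_misses m (u : dmap m n.+1) :
  reached e c (act u (sigma j)) -> exists2 i : 'I_n.+2, i != k & forall p, u p != i.
Proof.
have lt_e := ltn_ord e.
have miss i : i < n.+2 -> i <> k -> (forall p, u p <> i :> nat) ->
    exists2 i : 'I_n.+2, i != k & forall p, u p != i.
  move=> lt_i ik ui; exists (Ordinal lt_i).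
    by apply/eqP => /(congr1 (@nat_of_ord _)).
  by move=> p; apply/eqP => /(congr1 (@nat_of_ord _)); exact: ui.
case=> /= [/not_onto[v av]|tE|[i le_in [fi thr]]].
- have lt_v := ltn_ord v.
  (* The vertex missed by [u] lies over [v]. There are two such vertices, [j] and [j.+1], when [v]
     is [j]; the one that is not the hole is taken. *)
  apply: (miss (if v < j then v : nat else if v == j :> nat then
    if e == 0 :> nat then v.+1 else v : nat else v.+1)).
  + by do !case: ifP; lia.
  + by rewrite /= /prism_hole; do !case: ifP => /=; lia.
  + move=> p up; have /eqP := av p; apply; apply: ord_inj.
    rewrite !ffunE /= up; have := ltn_ord (u p).
    by move: up; rewrite /=; do !case: ifP; lia.
- apply: (miss (if e == 0 :> nat then n.+1 else 0)).
  + by case: ifP.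
  + by rewrite /= /prism_hole /prism_index; do !case: ifP; lia.
  + move=> p up; have := tE p; rewrite !ffunE /= up.
    by rewrite /= /prism_index; do !case: ifP; lia.
- apply: (miss (if e == 0 :> nat then j.+1 else j)).
  + by have := ltn_ord j; do !case: ifP; lia.
  + by rewrite /= /prism_hole; do !case: ifP; lia.
  + move=> p up; have := thr p; rewrite !ffunE /= up; move: fi.
    by rewrite /filled /= /prism_index; do !case: ifP; lia.
Qed.

Lemma reachedS m (x : sprod (simplex n) (simplex 1) m) :
  reached e c.+1 x <-> reached e c x \/ exists u, x = act u (sigma j).
Proof.
case: x => a t; split=> [|[|[u /(ex_intro _ u)/throughP at_j]]].
- case=> [?|?|[i le_in [fi thr]]]; [by left; constructor 1|by left; constructor 2|].
  have [ij|ij] := eqVneq i j.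
    by right; apply/throughP; rewrite -ij.
  left; constructor 3; exists i => //; split=> //.
  by move: fi ij; rewrite /filled /= /prism_index; do !case: ifP; lia.
- case=> [?|?|[i le_in [fi thr]]]; [by constructor 1|by constructor 2|constructor 3].
  by exists i => //; split=> //; move: fi; rewrite /filled; do !case: ifP; lia.
- constructor 3; exists j; first exact: leq_ord.
  by split=> //; rewrite /filled /= /prism_index; do !case: ifP; lia.
Qed.
End Step.

(** The prism simplex through (a, t) is the one that climbs at the last vertex which [a] takes on
    the bottom; if there is none, the empty maximum 0 is correct. *)
Lemma reached_all e m (x : sprod (simplex n) (simplex 1) m) : reached e n.+1 x.
Proof.
case: x => a t; constructor 3; exists (\max_(p | t p == 0 :> nat) a p).
  by apply/bigmax_leqP => p _; exact: leq_ord.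
split.
  rewrite /filled; case: ifP => _; first by rewrite addSn ltnS leq_addr.
  by rewrite ltnS; apply/bigmax_leqP => p _; exact: leq_ord.
move=> p /=; case: ifP => tp; first by rewrite (bigmax_sup p).
apply/bigmax_leqP => q tq; apply: dmap_le; rewrite leqNgt; apply/negP => /ltnW.
by move=> /(dmap_le t); rewrite (eqP tq) leqn0 tp.
Qed.
End Prism.

(** The problem prescribes a map on the cylinder over the boundary and on one end of the prism,
    which is the relation [R0]. It is extended over the n + 1 prism simplices, starting at the
    prescribed end, with one horn filling each. *)
Lemma kan_fills (K : sset) e : is_kan K -> fills (pend K e).
Proof.
move=> Kkan n b F Fact Fend.
pose V := sprod (simplex n) (simplex 1).
pose R0 : srel V K := fun m x z =>
  (exists na : ~ onto x.1, z = pfun (F m x.1 na) (did m) x.2) \/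
  ((forall p, x.2 p = e :> nat) /\ z = act x.1 b).
have FE m a na t k (f : dmap k m) (naf : ~ onto (dcomp a f)) :
    pfun (F k (dcomp a f) naf) (did k) (dcomp t f) = act f (pfun (F m a na) (did m) t).
  by rewrite (Fact _ _ na) pfun_did -pfun_act dcomp_idl.
have R0p : partial_map R0.
  split=> [m k f [a t] z|m [a t] z z'] /=.
    case=> [[na ->]|[tE ->]]; [left|right].
      have naf : ~ onto (dcomp a f) by move/dcomp_onto.
      by exists naf; rewrite FE.
    by split=> [p|]; [rewrite dcompE tE|rewrite act_comp].
  have mix na : (forall p, t p = e :> nat) -> pfun (F m a na) (did m) t = act a b.
    by move=> /dconstP ->; rewrite -(Fend _ _ na).
  case=> /= [[na ->]|[tE ->]] [[na' ->]|[tE' ->]] //.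
  - by rewrite (Prop_irrelevance na na').
  - exact: mix.
  - by rewrite mix.
have R0D m x : dom R0 x <-> reached e 0 (x : V m).
  split=> [[z [[na _]|[tE _]]]|]; [by constructor 1|by constructor 2|].
  case=> [na|tE|[i le_in []]]; [|by exists (act x.1 b); right|].
    by exists (pfun (F m x.1 na) (did m) x.2); left; exists na.
  by rewrite /filled; do !case: ifP; lia.
have [R [Rp R0R RD]] : exists R : srel V K, [/\ partial_map R,
    (forall m x z, R0 m x z -> R m x z)
  & forall m (x : V m), dom R x <-> reached e n.+1 x].
  suff: forall c, c <= n.+1 -> exists R : srel V K, [/\ partial_map R,
    (forall m x z, R0 m x z -> R m x z)
    & forall m (x : V m), dom R x <-> reached e c x] by apply.
  elim=> [_|c IH]; first by exists R0.
  rewrite ltnS => le_cn; have [R [Rp R0R RD]] := IH (leqW le_cn).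
  pose j := Ordinal (prism_index_lt e le_cn); pose k := Ordinal (prism_hole_lt e le_cn).
  have [y yP] : exists y : 'I_n.+2 -> K n, forall i, i != k ->
      R n (act (face n i) (sigma j)) (y i).
    suff /choice[y yP] : forall i : 'I_n.+2, exists z : K n, i != k ->
      R n (act (face n i) (sigma j)) z by exists y.
    (* The horn carries no face at [k]; [b] is only a default there. *)
    move=> i; case: (eqVneq i k) => [_|ik]; first by exists b.
    by have /RD[z ?] := reached_face ik; exists z.
  have [|x xP] := Kkan n k y.
    move=> i i' ik i'k m a a' aa'; have [Rcl Rfun] := Rp.
    apply: Rfun (Rcl _ _ a _ _ (yP _ ik)) _.
    rewrite -(act_comp (s := V)) aa' (act_comp (s := V)); exact: Rcl (yP _ i'k).
  have [Rcl Rfun] := Rp.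
  exists (attach R (sigma j) x); split.
  - apply: attach_partial => // [m u /RD/reached_misses[i ik /dmap_face[a ->]]|].
      by rewrite !act_comp xP //; exact: Rcl (yP _ ik).
    by move=> m u u' /sigma_inj.
  - by move=> m v z /R0R; left.
  - move=> m v; split=> [[z [Rz|[u [vu _]]]]|/(reachedS e le_cn)[/RD[z Rz]|[u vu]]].
    + by apply/(reachedS e le_cn); left; apply/RD; exists z.
    + by apply/(reachedS e le_cn); right; exists u.
    + by exists z; left.
    + by exists (act u x); right; exists u.
have [|H HP] := total_partial Rp; first by move=> m x; apply/RD/reached_all.
have [Rcl Rfun] := Rp.
pose p : path_space K n := @PathSimplex K n (fun m a t => H m (a, t))
  (fun m m' h a t => sapp_act H h ((a, t) : V m)).
exists p; split=> [|m a na].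
  rewrite /= /path_end /=; apply: Rfun (HP _ _) _; apply: R0R; right.
  by split=> [i|]; rewrite /= ?dmkE ?act_id.
apply: path_simplexP => m' f t /=; apply: Rfun (HP _ _) _; apply: R0R; left => /=.
have naf : ~ onto (dcomp a f) by move/dcomp_onto.
by exists naf; rewrite (Fact _ _ na) pfun_did.
Qed.

Lemma kan_hep (K : sset) : is_kan K -> hep K.
Proof. by move=> Kkan e; apply/fills_lifts/kan_fills. Qed.

(** * Path spaces, homotopy extension and equivalences *)

Section Graph.
Variables (V K : sset) (R : srel V K).
Hypothesis Rcl : forall m n (f : dmap m n) x y, @R n x y -> @R m (act f x) (act f y).

Definition graph_simplex n := {x : V n * K n | @R n x.1 x.2}.

Definition graph_act m n (f : dmap m n) (x : graph_simplex n) : graph_simplex m :=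
  exist _ (act f (sval x).1, act f (sval x).2) (Rcl f (svalP x)).

Lemma graph_simplexP n (x y : graph_simplex n) : sval x = sval y -> x = y.
Proof.
case: x y => [x Px] [y Py] /= e; case: y / e Py => Py.
by congr exist; exact: Prop_irrelevance.
Qed.

Fact graph_act_id n (x : graph_simplex n) : graph_act (did n) x = x.
Proof. by apply: graph_simplexP; rewrite /= !act_id -surjective_pairing. Qed.

Fact graph_act_comp m n k (g : dmap n k) (f : dmap m n) (x : graph_simplex k) :
  graph_act (dcomp g f) x = graph_act f (graph_act g x).
Proof. by apply: graph_simplexP; rewrite /= !act_comp. Qed.

Definition graph : sset := SSet graph_act_id graph_act_comp.

Definition graph_fst : smap graph V :=
  @SMap graph V (fun n x => (sval x).1) (fun _ _ _ _ => erefl).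
Definition graph_snd : smap graph K :=
  @SMap graph K (fun n x => (sval x).2) (fun _ _ _ _ => erefl).
End Graph.

Definition mono_lifts (E B : sset) (p : smap E B) : Prop :=
  forall (U V : sset) (i : smap U V) (F : smap U E) (G : smap V B),
    (forall n, injective (i n)) -> (forall n u, p n (F n u) = G n (i n u)) ->
    exists H : smap V E,
      (forall n u, H n (i n u) = F n u) /\ forall n v, p n (H n v) = G n v.

(** Partial maps are convenient for gluing, injective maps for composing. The graph of a partial map
    is a simplicial set which injects into [V] by its first projection. *)
Lemma liftsP (E B : sset) (p : smap E B) : lifts p <-> mono_lifts p.
Proof.
split=> [pL U V i F G i_inj FG|pL V R G [Rcl Rfun] RG].
  have [||H [HR HG]] := pL V (fun n v x => exists2 u, i n u = v & F n u = x) G.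
  - split=> [m n f _ _ [u <- <-]|n _ y y' [u <- <-] [u' /i_inj-> <-]//].
    by exists (act f u); rewrite sapp_act.
  - by move=> n _ _ [u <- <-].
  - by exists H; split=> // n u; apply: HR; exists u.
have [||H [HR HG]] := pL (graph Rcl) V (graph_fst Rcl) (graph_snd Rcl) G.
- move=> n [[x y] /= xy] [[x' y'] /= xy'] /= e; apply: graph_simplexP => /=.
  by rewrite -e in xy' *; rewrite (Rfun _ _ _ _ xy xy').
- by move=> n [[x y] /= /RG].
- by exists H; split=> // n x y xy; exact: HR (exist _ (x, y) xy).
Qed.

Definition empty_sset : sset :=
  @SSet (fun=> void) (fun _ _ _ x => x) (fun _ _ => erefl) (fun _ _ _ _ _ _ => erefl).

Definition from_empty (K : sset) : smap empty_sset K :=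
  @SMap empty_sset K (fun n x => match x with end) (fun m n f x => match x with end).

Lemma from_empty_inj K n : injective (from_empty K n).
Proof. by case. Qed.

Section PathMaps.
Variables K L : sset.

Fact pmap_subproof (f : smap K L) n (p : path_space K n) m m' (h : dmap m' m)
    (a : dmap m n) (t : dmap m 1) :
  f _ (pfun p (dcomp a h) (dcomp t h)) = act h (f _ (pfun p a t)).
Proof. by rewrite pfun_act sapp_act. Qed.

Fact pmap_act (f : smap K L) m n (h : dmap m n) (p : path_space K n) :
  PathSimplex (@pmap_subproof f m (act h p)) =
  act h (PathSimplex (@pmap_subproof f n p) : path_space L n).
Proof. exact: path_simplexP. Qed.

Definition pmap (f : smap K L) : smap (path_space K) (path_space L) :=
  @SMap (path_space K) (path_space L)
    (fun n p => @PathSimplex L n (fun m a t => f m (pfun p a t)) (@pmap_subproof f n p))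
    (@pmap_act f).

Definition cpath : smap K (path_space K) :=
  @SMap K (path_space K) (fun n x => const_path x) (fun m n f x => const_path_act f x).

Variable (V : sset).

Fact curry_subproof (H : smap (sprod V (simplex 1)) K) n (v : V n) m m'
    (h : dmap m' m) (a : dmap m n) (t : dmap m 1) :
  H m' ((act (dcomp a h) v, dcomp t h) : sprod V (simplex 1) m') =
  act h (H m ((act a v, t) : sprod V (simplex 1) m)).
Proof. by rewrite -sapp_act /= act_comp. Qed.

Fact curry_act (H : smap (sprod V (simplex 1)) K) m n (f : dmap m n) (v : V n) :
  PathSimplex (@curry_subproof H m (act f v)) =
  act f (PathSimplex (@curry_subproof H n v) : path_space K n).
Proof. by apply: path_simplexP => k a t; rewrite /= -act_comp. Qed.

Definition curry (H : smap (sprod V (simplex 1)) K) : smap V (path_space K) :=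
  @SMap V (path_space K) (fun n v => PathSimplex (@curry_subproof H n v)) (@curry_act H).

Lemma path_smapP (h k : smap V (path_space K)) :
  (forall n v t, pfun (h n v) (did n) t = pfun (k n v) (did n) t) ->
  forall n v, h n v = k n v.
Proof.
move=> hk n v; apply: path_simplexP => m a t.
by rewrite -[LHS]pfun_did -[RHS]pfun_did -!sapp_act.
Qed.
End PathMaps.
Arguments cpath : clear implicits.

Lemma path_end_pmap (K L : sset) (f : smap K L) n e (p : path_space K n) :
  path_end e (pmap f n p) = f n (path_end e p).
Proof. by []. Qed.

Lemma dconst_neq m : dconst m (ord0 : 'I_2) = dconst m ord_max -> False.
Proof.
by move=> /(congr1 (fun f : dmap m 1 => f ord0 : nat)); rewrite !dmkE.
Qed.

(* Pushout-product with the inclusion of the end points of the interval. *)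
Lemma lift_cyl (E B : sset) (p : smap E B) (U V : sset) (i : smap U V)
    (a0 a1 : smap V E) (h : smap U (path_space E)) (G : smap V (path_space B)) :
  lifts p -> (forall n, injective (i n)) ->
  (forall n v, p n (a0 n v) = path_end ord0 (G n v)) ->
  (forall n v, p n (a1 n v) = path_end ord_max (G n v)) ->
  (forall n u, path_end ord0 (h n u) = a0 n (i n u)) ->
  (forall n u, path_end ord_max (h n u) = a1 n (i n u)) ->
  (forall n u, pmap p n (h n u) = G n (i n u)) ->
  exists H : smap V (path_space E),
  [/\ (forall n v, path_end ord0 (H n v) = a0 n v),
      (forall n v, path_end ord_max (H n v) = a1 n v),
      (forall n u, H n (i n u) = h n u)
    & (forall n v, pmap p n (H n v) = G n v)].
Proof.
move=> pL i_inj pa0 pa1 h0 h1 ph.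
pose W := sprod V (simplex 1).
pose R : srel W E := fun n x y =>
  [\/ exists2 u, i n u = x.1 & pfun (h n u) (did n) x.2 = y,
      x.2 = dconst n ord0 /\ a0 n x.1 = y
    | x.2 = dconst n ord_max /\ a1 n x.1 = y].
have G_act m n (f : dmap m n) (x : W n) :
    pfun (G m (act f x).1) (did m) (act f x).2 = act f (pfun (G n x.1) (did n) x.2).
  by rewrite /= sapp_act -pfun_act dcomp_idl pfun_did.
pose GW : smap W B := @SMap W B (fun n x => pfun (G n x.1) (did n) x.2) G_act.
have hE0 n u : pfun (h n u) (did n) (dconst n ord0) = a0 n (i n u) by rewrite -h0.
have hE1 n u : pfun (h n u) (did n) (dconst n ord_max) = a1 n (i n u) by rewrite -h1.
have [||H [HR HG]] := pL W R GW.
- split=> [m n f [v t] y | n [v t] y y'] /=.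
    case=> [[u /= <- <-]|/= [-> <-]|/= [-> <-]].
    + constructor 1; exists (act f u); first by rewrite sapp_act.
      by rewrite sapp_act pfun_did -pfun_act dcomp_idl.
    + by constructor 2; rewrite dconst_comp sapp_act.
    + by constructor 3; rewrite dconst_comp sapp_act.
  case=> [[u /= <- <-]|/= [-> <-]|/= [-> <-]] [[u' /= e <-]|/= [e' <-]|/= [e' <-]] //.
  + by move/i_inj: e => ->.
  + by rewrite e' hE0.
  + by rewrite e' hE1.
  + by rewrite -e hE0.
  + by case: (dconst_neq e').
  + by rewrite -e hE1.
  + by case: (dconst_neq (esym e')).
- move=> n [v t] y /= [[u /= <- <-]|/= [-> <-]|/= [-> <-]].
  + by rewrite -ph.
  + by rewrite pa0.
  + by rewrite pa1.
exists (curry H); split=> n v.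
- by rewrite /path_end /= act_id; apply: HR; constructor 2.
- by rewrite /path_end /= act_id; apply: HR; constructor 3.
- apply: (path_smapP (h := scomp (curry H) i) (k := h)) => {}n {}v t /=.
  by rewrite act_id; apply: HR; constructor 1; exists v.
- apply: (path_smapP (h := scomp (pmap p) (curry H)) (k := G)) => {}n {}v t /=.
  by rewrite act_id HG.
Qed.

Lemma lift_cyl0 (E B : sset) (p : smap E B) (V : sset)
    (a0 a1 : smap V E) (G : smap V (path_space B)) :
  lifts p ->
  (forall n v, p n (a0 n v) = path_end ord0 (G n v)) ->
  (forall n v, p n (a1 n v) = path_end ord_max (G n v)) ->
  exists H : smap V (path_space E),
  [/\ (forall n v, path_end ord0 (H n v) = a0 n v),
      (forall n v, path_end ord_max (H n v) = a1 n v)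
    & (forall n v, pmap p n (H n v) = G n v)].
Proof.
move=> pL pa0 pa1.
have [|||H [H0 H1 _ HG]] := @lift_cyl _ _ p _ _ (from_empty V) a0 a1
  (from_empty _) G pL (@from_empty_inj V) pa0 pa1; try by move=> n [].
by exists H.
Qed.

Section Swap.
Variable K : sset.

Fact swap_subproof1 n (Q : path_space (path_space K) n) m (a : dmap m n) (t : dmap m 1)
    k k' (h : dmap k' k) (b : dmap k m) (s : dmap k 1) :
  pfun (pfun Q (dcomp a (dcomp b h)) (dcomp s h)) (did k') (dcomp t (dcomp b h)) =
  act h (pfun (pfun Q (dcomp a b) s) (did k) (dcomp t b)).
Proof. by rewrite !dcompA pfun_act pfun_did -pfun_act dcomp_idl. Qed.

Fact swap_subproof2 n (Q : path_space (path_space K) n) m m' (h : dmap m' m)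
    (a : dmap m n) (t : dmap m 1) :
  PathSimplex (@swap_subproof1 n Q m' (dcomp a h) (dcomp t h)) =
  act h (PathSimplex (@swap_subproof1 n Q m a t) : path_space K m).
Proof. by apply: path_simplexP => k b s; rewrite /= !dcompA. Qed.

Definition swap_fun n (Q : path_space (path_space K) n) : path_space (path_space K) n :=
  @PathSimplex (path_space K) n (fun m a t => PathSimplex (@swap_subproof1 n Q m a t))
    (@swap_subproof2 n Q).

Fact swap_act m n (f : dmap m n) (Q : path_space (path_space K) n) :
  swap_fun (act f Q) = act f (swap_fun Q).
Proof.
by apply: path_simplexP => k b s; apply: path_simplexP => l c t; rewrite /= !dcompA.
Qed.

(** A simplex of the double path space is a family of squares: [path_end] restricts to sides in the
    outer direction, [pmap (pend K e)] in the inner one, and [swap] exchanges the directions. *)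
Definition swap : smap (path_space (path_space K)) (path_space (path_space K)) :=
  SMap swap_act.

Lemma path_end_swap n e (Q : path_space (path_space K) n) :
  path_end e (swap n Q) = pmap (pend K e) n Q.
Proof.
by apply: path_simplexP => m a t /=; rewrite dcomp_idl dconst_comp.
Qed.

Lemma swapK n (Q : path_space (path_space K) n) : swap n (swap n Q) = Q.
Proof.
apply: path_simplexP => m a t; apply: path_simplexP => k b s /=.
by rewrite !dcomp_idr pfun_act pfun_did.
Qed.

Lemma pmap_end_swap n e (Q : path_space (path_space K) n) :
  pmap (pend K e) n (swap n Q) = path_end e Q.
Proof.
apply: path_simplexP => m a t /=; rewrite /path_end /= !dcomp_idr.
by rewrite pfunE pfun_did.
Qed.
End Swap.

Section HpbMaps.
Variables (B C D : sset) (f : smap B D) (g : smap C D).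

Definition hpb_pth : smap (hpb f g) (path_space D) :=
  @SMap (hpb f g) (path_space D) (fun n s => hpb_path s) (fun _ _ _ _ => erefl).

Section Intro.
Variables (V : sset) (b : smap V B) (c : smap V C) (h : smap V (path_space D)).
Hypothesis h0 : forall n v, path_end ord0 (h n v) = f n (b n v).
Hypothesis h1 : forall n v, path_end ord_max (h n v) = g n (c n v).

Fact hpb_mk_act m n (a : dmap m n) (v : V n) :
  HpbSimplex (h0 (act a v)) (h1 (act a v)) =
  act a (HpbSimplex (h0 v) (h1 v) : hpb f g n).
Proof. by apply: hpb_simplexP; rewrite /= sapp_act. Qed.

Definition hpb_mk : smap V (hpb f g) :=
  @SMap V (hpb f g) (fun n v => HpbSimplex (h0 v) (h1 v)) hpb_mk_act.
End Intro.

Section PathIntro.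
Variables (V : sset) (b : smap V (path_space B)) (c : smap V (path_space C)).
Variable h : smap V (path_space (path_space D)).
Hypothesis h0 : forall n v, pmap (pend D ord0) n (h n v) = pmap f n (b n v).
Hypothesis h1 : forall n v, pmap (pend D ord_max) n (h n v) = pmap g n (c n v).

Fact hpb_path_mk_start n (v : V n) m (a : dmap m n) (t : dmap m 1) :
  path_end ord0 (pfun (h n v) a t) = f m (pfun (b n v) a t).
Proof. exact: (congr1 (fun p : path_simplex _ _ => pfun p a t) (h0 v)). Qed.

Fact hpb_path_mk_end n (v : V n) m (a : dmap m n) (t : dmap m 1) :
  path_end ord_max (pfun (h n v) a t) = g m (pfun (c n v) a t).
Proof. exact: (congr1 (fun p : path_simplex _ _ => pfun p a t) (h1 v)). Qed.

Fact hpb_path_mk_pfun n (v : V n) m m' (k : dmap m' m) (a : dmap m n) (t : dmap m 1) :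
  HpbSimplex (hpb_path_mk_start v (dcomp a k) (dcomp t k))
             (hpb_path_mk_end v (dcomp a k) (dcomp t k)) =
  act k (HpbSimplex (hpb_path_mk_start v a t) (hpb_path_mk_end v a t) : hpb f g m).
Proof. by apply: hpb_simplexP; rewrite /= pfun_act. Qed.

Definition hpb_path_mk_fun n (v : V n) : path_space (hpb f g) n :=
  @PathSimplex (hpb f g) n
    (fun m a t => HpbSimplex (hpb_path_mk_start v a t) (hpb_path_mk_end v a t))
    (@hpb_path_mk_pfun n v).

Fact hpb_path_mk_act m n (k : dmap m n) (v : V n) :
  hpb_path_mk_fun (act k v) = act k (hpb_path_mk_fun v).
Proof.
by apply: path_simplexP => l a t; apply: hpb_simplexP; rewrite /= sapp_act.
Qed.

Definition hpb_path_mk : smap V (path_space (hpb f g)) := SMap hpb_path_mk_act.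
End PathIntro.
End HpbMaps.

(** Lifting in [B] and [C] gives two opposite sides of a square in [D], and [G] gives a third one;
    [lift_cyl] fills it compatibly with [F]. The swap turns it from a homotopy between paths into a
    path of points of the pullback. *)
Lemma hep_hpb (B C D : sset) (f : smap B D) (g : smap C D) :
  hep B -> hep C -> hep D -> hep (hpb f g).
Proof.
move=> Bh Ch Dh e; apply/liftsP => U V i F G i_inj FG.
have [|b [bF bG]] := (liftsP _).1 (Bh e) _ _ i
  (scomp (pmap (hpb_fst f g)) F) (scomp (hpb_fst f g) G) i_inj.
  by move=> n u; rewrite /= -FG.
have [|c [cF cG]] := (liftsP _).1 (Ch e) _ _ i
  (scomp (pmap (hpb_snd f g)) F) (scomp (hpb_snd f g) G) i_inj.
  by move=> n u; rewrite /= -FG.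
have [|||||h [h0 h1 hF hG]] := @lift_cyl _ _ (pend D e) _ _ i
  (scomp (pmap f) b) (scomp (pmap g) c) (scomp (swap D) (scomp (pmap (hpb_pth f g)) F))
  (scomp (hpb_pth f g) G) (Dh e) i_inj.
- by move=> n v; rewrite [RHS]hpb_start -[hpb1 _]bG.
- by move=> n v; rewrite [RHS]hpb_end -[hpb2 _]cG.
- move=> n u; rewrite path_end_swap /= bF; apply: path_simplexP => m a t.
  exact: hpb_start.
- move=> n u; rewrite path_end_swap /= cF; apply: path_simplexP => m a t.
  exact: hpb_end.
- by move=> n u; rewrite pmap_end_swap /= -FG.
have h0' n v : pmap (pend D ord0) n (swap D n (h n v)) = pmap f n (b n v).
  by rewrite pmap_end_swap h0.
have h1' n v : pmap (pend D ord_max) n (swap D n (h n v)) = pmap g n (c n v).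
  by rewrite pmap_end_swap h1.
exists (hpb_path_mk (h := scomp (swap D) h) h0' h1'); split=> n v.
  apply: path_simplexP => m a t; apply: hpb_simplexP.
  - exact: (congr1 (fun p : path_simplex _ _ => pfun p a t) (bF n v)).
  - exact: (congr1 (fun p : path_simplex _ _ => pfun p a t) (cF n v)).
  - have e' : swap D n (h n (i n v)) = pmap (hpb_pth f g) n (F n v).
      by rewrite hF; exact: swapK.
    exact: (congr1 (fun p : path_simplex _ _ => pfun p a t) e').
apply: hpb_simplexP; [exact: bG|exact: cG|].
by apply: etrans (hG _ _); exact: path_end_swap.
Qed.

(* The path fibration replacing f is a trivial fibration. *)
Definition weq (K L : sset) (f : smap K L) : Prop := lifts (hpb_snd f (sid L)).

(** This projection is the pullback of the trivial fibration [pend L ord0] along [f]. *)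
Lemma hep_smap_fst (K L : sset) (f : smap K L) : hep L -> lifts (hpb_fst f (sid L)).
Proof.
move=> Lh; apply/liftsP => U V i F G i_inj FG.
have [|h [hF hG]] := (liftsP _).1 (Lh ord0) _ _ i (scomp (hpb_pth f (sid L)) F)
  (scomp f G) i_inj.
  by move=> n u; exact: etrans (hpb_start _) (congr1 (f n) (FG n u)).
exists (@hpb_mk _ _ _ f (sid L) V G (scomp (pend L ord_max) h) h hG (fun _ _ => erefl)).
split=> n v //; apply: hpb_simplexP; [exact/esym/FG| |exact: hF].
by rewrite /= hF; exact: hpb_end.
Qed.

Lemma lifts_section_homotopic (E B : sset) (p : smap E B) (s : smap B E) :
  lifts p -> (forall n x, p n (s n x) = x) -> homotopic (scomp s p) (sid E).
Proof.
move=> pL ps; have [||H [H0 H1 _]] := @lift_cyl0 _ _ p E (scomp s p) (sid E)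
  (scomp (cpath B) p) pL.
- by move=> n v; rewrite path_end_const /= ps.
- by move=> n v; rewrite path_end_const.
- by exists H.
Qed.

Lemma lifts_is_equiv (E B : sset) (p : smap E B) : lifts p -> is_equiv p.
Proof.
move=> pL; have [|s [_ ps]] := (liftsP p).1 pL _ _ (from_empty B) (from_empty E)
  (sid B) (@from_empty_inj B); first by move=> n [].
exists s; split; first exact: lifts_section_homotopic.
by exists (cpath B) => n x; rewrite !path_end_const /= ps.
Qed.

Lemma weq_is_equiv (K L : sset) (f : smap K L) : weq f -> is_equiv f.
Proof.
move=> fL; have [|s [_ ps]] := (liftsP _).1 fL _ _ (from_empty L) (from_empty _)
  (sid L) (@from_empty_inj L); first by move=> n [].
pose g := scomp (hpb_fst f (sid L)) s.
pose r : smap K (hpb f (sid L)) := @hpb_mk _ _ _ f (sid L) K (sid K) f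
  (scomp (cpath L) f) (fun n x => path_end_const _ _) (fun n x => path_end_const _ _).
(* Both [scomp s f] and [r] are lifts of [f] along a trivial fibration, hence homotopic; in [K] this
   reads as a homotopy from [scomp g f] to the identity. *)
have [||H [H0 H1 _]] := @lift_cyl0 _ _ (hpb_snd f (sid L)) K (scomp s f) r
  (scomp (cpath L) f) fL.
- by move=> n v; rewrite path_end_const; exact: ps.
- by move=> n v; rewrite path_end_const.
exists g; split.
  exists (scomp (pmap (hpb_fst f (sid L))) H) => n x; split.
    by rewrite [LHS]path_end_pmap H0.
  by rewrite [LHS]path_end_pmap H1.
exists (scomp (hpb_pth f (sid L)) s) => n x; split; first exact: hpb_start.
by rewrite [LHS]hpb_end [LHS]ps.
Qed.

(** Composing with the homotopy [H] turns a path from [f k] to [l] into a path from [k] to [l], for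
    which the lifting problem is [hep]. The square [S] makes this change on [U]; the square [T],
    extending [S], undoes it on [V]. *)
Lemma homotopic_id_weq (K : sset) (f : smap K K) :
  hep K -> homotopic f (sid K) -> weq f.
Proof.
move=> Kh [H HP]; have H0 n x := (HP n x).1; have H1 n x := (HP n x).2.
apply/liftsP => U V i kh l i_inj ihl.
pose k := scomp (hpb_fst f (sid K)) kh; pose h := scomp (hpb_pth f (sid K)) kh.
have h0 n u : path_end ord0 (h n u) = f n (k n u) by exact: hpb_start.
have h1 n u : path_end ord_max (h n u) = l n (i n u) by rewrite [LHS]hpb_end [LHS]ihl.
have [||S [S0 S1 Sh]] := @lift_cyl0 _ _ (pend K ord0) U (scomp H k)
  (scomp (cpath K) (scomp l i)) h (Kh _).
- by move=> n u; rewrite h0 [LHS]H0.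
- by move=> n u; rewrite h1 [LHS]path_end_const.
pose r := scomp (pmap (pend K ord_max)) S.
have r0 n u : path_end ord0 (r n u) = k n u.
  by rewrite [LHS]path_end_pmap S0 [LHS]H1.
have r1 n u : path_end ord_max (r n u) = l n (i n u).
  by rewrite [LHS]path_end_pmap S1 [LHS]path_end_const.
have [R [Rr R1]] := (liftsP _).1 (Kh ord_max) _ _ i r l i_inj r1.
pose k' := scomp (pend K ord0) R.
have k'k n u : k' n (i n u) = k n u by rewrite /k' /= Rr r0.
have [|||||T [T0 T1 TS TR]] := @lift_cyl _ _ (pend K ord_max) U V i (scomp H k')
  (scomp (cpath K) l) S R (Kh _) i_inj.
- by move=> n v; rewrite [LHS]H1.
- by move=> n v; rewrite [RHS]R1 [LHS]path_end_const.
- by move=> n u; rewrite S0; exact: (congr1 (H n) (esym (k'k n u))).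
- by move=> n u; rewrite S1.
- by move=> n u; rewrite Rr.
have h'0 n v : path_end ord0 (pmap (pend K ord0) n (T n v)) = f n (k' n v).
  by rewrite path_end_pmap T0 /= H0.
have h'1 n v : path_end ord_max (pmap (pend K ord0) n (T n v)) = l n v.
  by rewrite path_end_pmap T1 [LHS]path_end_const.
exists (@hpb_mk _ _ _ f (sid K) V k' l (scomp (pmap (pend K ord0)) T) h'0 h'1).
split=> n v //; apply: hpb_simplexP.
- exact: k'k.
- by rewrite [RHS]ihl.
- by rewrite [LHS](congr1 (pmap (pend K ord0) n) (TS n v)) Sh.
Qed.

(* A homotopy filler for g f, pushed along f, is a lifting problem for f g
   whose solution is the homotopy sought for f. *)
Lemma weq_2of6 (K L : sset) (f : smap K L) (g : smap L K) :
  weq (scomp g f) -> weq (scomp f g) -> weq f.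
Proof.
move=> gfL fgL; apply/liftsP => U V i kh l i_inj ihl.
pose k := scomp (hpb_fst f (sid L)) kh; pose h := scomp (hpb_pth f (sid L)) kh.
have h0 n u : path_end ord0 (h n u) = f n (k n u) by exact: hpb_start.
have h1 n u : path_end ord_max (h n u) = l n (i n u) by rewrite [LHS]hpb_end [LHS]ihl.
have gh0 n u : path_end ord0 (pmap g n (h n u)) = scomp g f n (k n u).
  by rewrite path_end_pmap h0.
have gh1 n u : path_end ord_max (pmap g n (h n u)) = g n (l n (i n u)).
  by rewrite path_end_pmap h1.
have [|kh' [kh'E kh'l]] := (liftsP _).1 gfL U V i
  (@hpb_mk _ _ _ (scomp g f) (sid K) U k (scomp g (scomp l i)) (scomp (pmap g) h)
    gh0 gh1) (scomp g l) i_inj.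
  by [].
pose k' := scomp (hpb_fst (scomp g f) (sid K)) kh'.
pose h' := scomp (hpb_pth (scomp g f) (sid K)) kh'.
have k'k n u : k' n (i n u) = k n u by exact: (congr1 (@hpb1 _ _ _ _ _ _) (kh'E n u)).
pose q : smap L (hpb (scomp f g) (sid L)) := @hpb_mk _ _ _ (scomp f g) (sid L) L
  (sid L) (scomp f g) (scomp (cpath L) (scomp f g))
  (fun n x => path_end_const _ _) (fun n x => path_end_const _ _).
have [|||||H [H0 H1 Hh _]] := @lift_cyl _ _ (hpb_snd (scomp f g) (sid L)) U V i
  (scomp q (scomp f k')) (scomp q l) (scomp (pmap q) h) (scomp (pmap f) h') fgL i_inj.
- by move=> n v; rewrite path_end_pmap [path_end _ _]hpb_start.
- by move=> n v; rewrite path_end_pmap [path_end _ _]hpb_end [hpb2 _]kh'l.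
- move=> n u; rewrite path_end_pmap h0.
  exact: (congr1 (fun x => q n (f n x)) (esym (k'k n u))).
- by move=> n u; rewrite path_end_pmap h1.
- move=> n u; apply: path_simplexP => m a t /=; congr (f m _).
  by rewrite /h' /= kh'E.
have h''0 n v : path_end ord0 (pmap (hpb_fst _ _) n (H n v)) = f n (k' n v).
  by rewrite path_end_pmap H0.
have h''1 n v : path_end ord_max (pmap (hpb_fst _ _) n (H n v)) = l n v.
  by rewrite path_end_pmap H1.
exists (@hpb_mk _ _ _ f (sid L) V k' l (scomp (pmap (hpb_fst _ _)) H) h''0 h''1).
split=> n v //; apply: hpb_simplexP.
- exact: k'k.
- by rewrite [RHS]ihl.
- rewrite [LHS](congr1 (pmap (hpb_fst _ _) n) (Hh n v)).
  exact: path_simplexP.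
Qed.

Lemma is_equiv_weq (K L : sset) (f : smap K L) :
  hep K -> hep L -> is_equiv f -> weq f.
Proof.
by move=> Kh Lh [g [gf fg]]; apply: (@weq_2of6 _ _ _ g); exact: homotopic_id_weq.
Qed.

(** * Homotopy pullbacks *)

Lemma homotopic_eq (K L : sset) (f g : smap K L) :
  (forall n x, f n x = g n x) -> homotopic f g.
Proof.
move=> fg; exists (scomp (cpath L) f) => n x.
by rewrite !path_end_const [RHS]fg.
Qed.

Lemma homotopic_compl (K L M : sset) (h : smap L M) (f g : smap K L) :
  homotopic f g -> homotopic (scomp h f) (scomp h g).
Proof.
move=> [H HP]; exists (scomp (pmap h) H) => n x.
by have [H0 H1] := HP n x; rewrite !path_end_pmap H0 H1.
Qed.

Lemma homotopic_compr (K L M : sset) (h : smap K L) (f g : smap L M) :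
  homotopic f g -> homotopic (scomp f h) (scomp g h).
Proof. by move=> [H HP]; exists (scomp H h) => n x; exact: HP. Qed.

(** Three sides of a square are given and the fourth is read off: here [H] and two constant sides
    yield the reverse of [H]; in [homotopic_trans] the sides are [H], [H'] and a constant one. *)
Lemma homotopic_sym (K L : sset) (f g : smap K L) :
  hep L -> homotopic f g -> homotopic g f.
Proof.
move=> Lh [H HP].
have [||Q [Q0 Q1 _]] := @lift_cyl0 _ _ (pend L ord0) K H (scomp (cpath L) f)
  (scomp (cpath L) f) (Lh _).
- by move=> n x; rewrite path_end_const [LHS](HP n x).1.
- by move=> n x; rewrite path_end_const [LHS]path_end_const.
exists (scomp (pmap (pend L ord_max)) Q) => n x.
by rewrite !path_end_pmap Q0 Q1 [pend _ _ _ (H n x)](HP n x).2 [pend _ _ _ _]path_end_const.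
Qed.

Lemma homotopic_trans (K L : sset) (f g h : smap K L) :
  hep L -> homotopic f g -> homotopic g h -> homotopic f h.
Proof.
move=> Lh [H HP] [H' HP'].
have [||Q [Q0 Q1 _]] := @lift_cyl0 _ _ (pend L ord0) K (scomp (cpath L) f) H' H (Lh _).
- by move=> n x; rewrite (HP n x).1 [LHS]path_end_const.
- by move=> n x; rewrite (HP n x).2 [LHS](HP' n x).1.
exists (scomp (pmap (pend L ord_max)) Q) => n x.
by rewrite !path_end_pmap Q0 Q1 [pend _ _ _ (H' n x)](HP' n x).2 [pend _ _ _ _]path_end_const.
Qed.

Lemma is_equiv_eq (K L : sset) (f g : smap K L) :
  (forall n x, f n x = g n x) -> is_equiv f -> is_equiv g.
Proof. by move=> /smapP->. Qed.

Lemma is_equiv_iso (K L : sset) (f : smap K L) (g : smap L K) :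
  (forall n x, g n (f n x) = x) -> (forall n x, f n (g n x) = x) -> is_equiv f.
Proof. by move=> gf fg; exists g; split; exact: homotopic_eq. Qed.

Lemma is_equiv_id (K : sset) : is_equiv (sid K).
Proof. exact: (is_equiv_iso (g := sid K)). Qed.

Lemma is_equiv_comp (K L M : sset) (f : smap K L) (g : smap L M) :
  hep K -> hep M -> is_equiv f -> is_equiv g -> is_equiv (scomp g f).
Proof.
move=> Kh Mh [f' [f'f ff']] [g' [g'g gg']]; exists (scomp f' g'); split.
  apply: homotopic_trans f'f => //.
  exact: (homotopic_compl f' (homotopic_compr f g'g)).
apply: homotopic_trans gg' => //.
exact: (homotopic_compl g (homotopic_compr g' ff')).
Qed.

Lemma is_equiv_cancel_l (K L M : sset) (f : smap K L) (g : smap L M) :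
  hep L -> is_equiv g -> is_equiv (scomp g f) -> is_equiv f.
Proof.
move=> Lh [g' [g'g gg']] [k [kgf gfk]]; exists (scomp k g); split=> //.
apply: homotopic_trans (homotopic_sym Lh (homotopic_compr (scomp f (scomp k g)) g'g)) _ => //.
apply: homotopic_trans g'g => //.
exact: (homotopic_compl g' (homotopic_compr g gfk)).
Qed.

Lemma is_equiv_cancel_r (K L M : sset) (f : smap K L) (g : smap L M) :
  hep L -> is_equiv f -> is_equiv (scomp g f) -> is_equiv g.
Proof.
move=> Lh [f' [f'f ff']] [k [kgf gfk]]; exists (scomp f k); split=> //.
apply: homotopic_trans (homotopic_compl (scomp f (scomp k g)) (homotopic_sym Lh ff')) _ => //.
apply: homotopic_trans ff' => //.
exact: (homotopic_compl f (homotopic_compr f' kgf)).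
Qed.

Lemma lifts_section (E B : sset) (p : smap E B) (s : smap B E) :
  lifts p -> (forall n x, p n (s n x) = x) -> is_equiv s.
Proof.
move=> pL ps; exists p; split; first exact: homotopic_eq.
exact: lifts_section_homotopic.
Qed.

Definition path_unit (K L : sset) (f : smap K L) : smap K (hpb f (sid L)) :=
  @hpb_mk _ _ _ f (sid L) K (sid K) f (scomp (cpath L) f)
    (fun n x => path_end_const _ _) (fun n x => path_end_const _ _).

Lemma path_unit_equiv (K L : sset) (f : smap K L) : hep L -> is_equiv (path_unit f).
Proof. by move=> Lh; apply: (@lifts_section _ _ (hpb_fst f (sid L))) => //; exact: hep_smap_fst. Qed.

Section HpbMap.
Variables (B C D B' C' D' : sset).
Variables (f : smap B D) (g : smap C D) (f' : smap B' D') (g' : smap C' D').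
Variables (b : smap B B') (c : smap C C') (e : smap D D').
Hypothesis ef : forall n x, e n (f n x) = f' n (b n x).
Hypothesis eg : forall n x, e n (g n x) = g' n (c n x).

Fact hpb_map_start n (x : hpb f g n) :
  path_end ord0 (pmap e n (hpb_path x)) = f' n (b n (hpb1 x)).
Proof. by rewrite path_end_pmap hpb_start ef. Qed.

Fact hpb_map_end n (x : hpb f g n) :
  path_end ord_max (pmap e n (hpb_path x)) = g' n (c n (hpb2 x)).
Proof. by rewrite path_end_pmap hpb_end eg. Qed.

Definition hpb_map : smap (hpb f g) (hpb f' g') :=
  @hpb_mk _ _ _ f' g' (hpb f g) (scomp b (hpb_fst f g)) (scomp c (hpb_snd f g))
    (scomp (pmap e) (hpb_pth f g)) hpb_map_start hpb_map_end.

Lemma hpb_map_lifts : lifts b -> lifts c -> lifts e -> lifts hpb_map.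
Proof.
move=> bL cL eL; apply/liftsP => U V i F G i_inj FG.
have [|x [xF xG]] := (liftsP _).1 bL U V i (scomp (hpb_fst f g) F)
  (scomp (hpb_fst f' g') G) i_inj.
  by move=> n u; rewrite /= -FG.
have [|y [yF yG]] := (liftsP _).1 cL U V i (scomp (hpb_snd f g) F)
  (scomp (hpb_snd f' g') G) i_inj.
  by move=> n u; rewrite /= -FG.
have [|||||h [h0 h1 hF hG]] := @lift_cyl _ _ e U V i (scomp f x) (scomp g y)
  (scomp (hpb_pth f g) F) (scomp (hpb_pth f' g') G) eL i_inj.
- by move=> n v; rewrite [LHS]ef [RHS]hpb_start xG.
- by move=> n v; rewrite [LHS]eg [RHS]hpb_end yG.
- by move=> n u; rewrite /= xF; exact: hpb_start.
- by move=> n u; rewrite /= yF; exact: hpb_end.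
- by move=> n u; rewrite /= -FG.
exists (hpb_mk h0 h1); split=> n v; apply: hpb_simplexP;
  [exact: xF|exact: yF|exact: hF|exact: xG|exact: yG|exact: hG].
Qed.
End HpbMap.

(* Ken Brown's argument: the mapping path spaces form a cospan with levelwise
   trivial fibrations to both given ones. *)
Lemma hpb_map_equiv (B C D B' C' D' : sset)
    (f : smap B D) (g : smap C D) (f' : smap B' D') (g' : smap C' D')
    (b : smap B B') (c : smap C C') (e : smap D D')
    (ef : forall n x, e n (f n x) = f' n (b n x))
    (eg : forall n x, e n (g n x) = g' n (c n x)) :
  hep B -> hep C -> hep D -> hep B' -> hep C' -> hep D' ->
  is_equiv b -> is_equiv c -> is_equiv e -> is_equiv (hpb_map ef eg).
Proof.
move=> Bh Ch Dh B'h C'h D'h b_eq c_eq e_eq.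
pose Ef := @hpb_map _ _ _ _ _ _ b (sid B') e (sid D') f f' f'
  (fun n x => esym (ef n x)) (fun _ _ => erefl).
pose Eg := @hpb_map _ _ _ _ _ _ c (sid C') e (sid D') g g' g'
  (fun n x => esym (eg n x)) (fun _ _ => erefl).
pose tgt := @hpb_map _ _ _ _ _ _ Ef Eg f' g' (hpb_snd _ _) (hpb_snd _ _) (hpb_snd _ _)
  (fun _ _ => erefl) (fun _ _ => erefl).
pose src := @hpb_map _ _ _ _ _ _ Ef Eg f g (hpb_fst _ _) (hpb_fst _ _) (hpb_fst _ _)
  (fun _ _ => erefl) (fun _ _ => erefl).
have sf n x : path_unit e n (f n x) = Ef n (path_unit b n x).
  apply: hpb_simplexP => //=; apply: path_simplexP => m a t /=.
  by rewrite -!sapp_act ef.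
have sg n x : path_unit e n (g n x) = Eg n (path_unit c n x).
  apply: hpb_simplexP => //=; apply: path_simplexP => m a t /=.
  by rewrite -!sapp_act eg.
pose s := hpb_map sf sg.
(* The map in question is [tgt] after [s], where [tgt] is a trivial fibration and [s] is a section
   of the trivial fibration [src]. *)
apply: (@is_equiv_eq _ _ (scomp tgt s)) => [n x|].
  by apply: hpb_simplexP => //=; apply: path_simplexP.
apply: is_equiv_comp; [exact: hep_hpb|exact: hep_hpb| |].
- apply: (@lifts_section _ _ src) => [|n x].
    by apply: hpb_map_lifts; exact: hep_smap_fst.
  by apply: hpb_simplexP => //=; exact: path_simplexP.
- by apply/lifts_is_equiv/hpb_map_lifts; exact: is_equiv_weq.
Qed.

Lemma is_pullbackP (A B C D : sset) (p : smap A B) (q : smap A C)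
    (f : smap B D) (g : smap C D) (e : forall n x, f n (p n x) = g n (q n x)) :
  is_pullback p q f g <-> is_equiv (hpb_cmp e).
Proof.
by split=> [[e']|]; [rewrite (Prop_irrelevance e' e)|exists e].
Qed.

Section Invariance.
Variables (A B C D A' B' C' D' : sset).
Variables (p : smap A B) (q : smap A C) (f : smap B D) (g : smap C D).
Variables (p' : smap A' B') (q' : smap A' C') (f' : smap B' D') (g' : smap C' D').
Variables (a : smap A A') (b : smap B B') (c : smap C C') (e : smap D D').
Hypothesis fp : forall n x, f n (p n x) = g n (q n x).
Hypothesis fp' : forall n x, f' n (p' n x) = g' n (q' n x).
Hypothesis bp : forall n x, b n (p n x) = p' n (a n x).
Hypothesis cq : forall n x, c n (q n x) = q' n (a n x).
Hypothesis ef : forall n x, e n (f n x) = f' n (b n x).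
Hypothesis eg : forall n x, e n (g n x) = g' n (c n x).
Hypotheses (Ah : hep A) (Bh : hep B) (Ch : hep C) (Dh : hep D).
Hypotheses (A'h : hep A') (B'h : hep B') (C'h : hep C') (D'h : hep D').
Hypotheses (a_eq : is_equiv a) (b_eq : is_equiv b) (c_eq : is_equiv c) (e_eq : is_equiv e).

Lemma is_pullback_equiv : is_pullback p q f g <-> is_pullback p' q' f' g'.
Proof.
rewrite (is_pullbackP fp) (is_pullbackP fp').
have E n x : scomp (hpb_map ef eg) (hpb_cmp fp) n x = scomp (hpb_cmp fp') a n x.
  apply: hpb_simplexP; [exact: bp|exact: cq|].
  by apply: path_simplexP => m h t /=; rewrite -!sapp_act /= ef bp.
have H : is_equiv (hpb_map ef eg) by exact: hpb_map_equiv.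
split=> cmp_eq.
  apply: (@is_equiv_cancel_r _ _ _ a) => //.
  by apply: is_equiv_eq E _; apply: is_equiv_comp => //; exact: hep_hpb.
apply: (@is_equiv_cancel_l _ _ _ _ (hpb_map ef eg)) => //; first exact: hep_hpb.
by rewrite (smapP E); apply: is_equiv_comp => //; exact: hep_hpb.
Qed.
End Invariance.

Section Pasting.
Variables (A2 A1 A0 B2 B1 B0 : sset).
Variables (r2 : smap A2 B2) (r1 : smap A1 B1) (r0 : smap A0 B0).
Variables (q : smap A2 A1) (w : smap A1 A0) (u : smap B2 B1) (v : smap B1 B0).
Hypothesis ur : forall n x, u n (r2 n x) = r1 n (q n x).
Hypotheses (A2h : hep A2) (A1h : hep A1) (A0h : hep A0).
Hypotheses (B2h : hep B2) (B1h : hep B1) (B0h : hep B0).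

Let T := hpb u (hpb_fst v r0).
Let M := hpb (scomp v (hpb_snd u (sid B1))) r0.

(** Replacing [u] by its mapping path space in [M] keeps the path in [B1] as a separate datum, so
    that the two bracketings are even isomorphic. *)
Lemma hpb_assoc_equiv : exists2 i : smap M T, is_equiv i &
  forall n x, [/\ hpb1 (i n x) = hpb1 (hpb1 x), hpb_path (i n x) = hpb_path (hpb1 x),
    hpb1 (hpb2 (i n x)) = hpb2 (hpb1 x), hpb2 (hpb2 (i n x)) = hpb2 x
  & hpb_path (hpb2 (i n x)) = hpb_path x].
Proof.
pose y : smap M (hpb v r0) := @hpb_mk _ _ _ v r0 M
  (scomp (hpb_snd _ _) (hpb_fst _ _)) (hpb_snd _ _) (hpb_pth _ _)
  (fun n x => hpb_start x) (fun n x => hpb_end x).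
pose i : smap M T := @hpb_mk _ _ _ u (hpb_fst v r0) M
  (scomp (hpb_fst _ _) (hpb_fst _ _)) y (scomp (hpb_pth _ _) (hpb_fst _ _))
  (fun n x => hpb_start _) (fun n x => hpb_end _).
pose z : smap T (hpb u (sid B1)) := @hpb_mk _ _ _ u (sid B1) T
  (hpb_fst _ _) (scomp (hpb_fst _ _) (hpb_snd _ _)) (hpb_pth _ _)
  (fun n x => hpb_start _) (fun n x => hpb_end _).
pose j : smap T M := @hpb_mk _ _ _ (scomp v (hpb_snd u (sid B1))) r0 T
  z (scomp (hpb_snd _ _) (hpb_snd _ _)) (scomp (hpb_pth _ _) (hpb_snd _ _))
  (fun n x => hpb_start _) (fun n x => hpb_end _).
exists i => //; apply: (is_equiv_iso (g := j)) => n x.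
  by apply: hpb_simplexP => //; exact: hpb_simplexP.
by apply: hpb_simplexP => //; exact: hpb_simplexP.
Qed.

(** After the equivalences [psi] and [scomp i k] the two comparison maps become the same map into
    [T], so one is an equivalence exactly when the other is. *)
Lemma pullback_paste : is_pullback r1 w v r0 ->
  is_pullback r2 q u r1 <-> is_pullback r2 (scomp w q) (scomp v u) r0.
Proof.
move=> [vr R_eq].
have outer n x : scomp v u n (r2 n x) = r0 n (scomp w q n x) by rewrite /= ur vr.
rewrite (is_pullbackP ur) (is_pullbackP outer).
have [i i_eq iE] := hpb_assoc_equiv.
have Mh : hep M by do !apply: hep_hpb.
have Th : hep T by do !apply: hep_hpb.
pose k : smap (hpb (scomp v u) r0) M := @hpb_map _ _ _ _ _ _ (scomp v u) r0
  (scomp v (hpb_snd u (sid B1))) r0 (path_unit u) (sid A0) (sid B0) (fun _ _ => erefl) (fun _ _ => erefl).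
have k_eq : is_equiv k.
  by apply: hpb_map_equiv; rewrite //; try exact: is_equiv_id;
     [exact: hep_hpb|exact: path_unit_equiv].
pose psi : smap (hpb u r1) T := @hpb_map _ _ _ _ _ _ u r1 u (hpb_fst v r0)
  (sid B2) (hpb_cmp vr) (sid B1) (fun _ _ => erefl) (fun _ _ => erefl).
have psi_eq : is_equiv psi.
  by apply: hpb_map_equiv; rewrite //; try exact: is_equiv_id; exact: hep_hpb.
have E n x : scomp psi (hpb_cmp ur) n x = scomp (scomp i k) (hpb_cmp outer) n x.
  have [e1 e2 e3 e4 e5] := iE n (k n (hpb_cmp outer n x)).
  apply: hpb_simplexP; rewrite /= ?e1 ?e2 //.
    apply: hpb_simplexP; rewrite ?e3 ?e4 ?e5 //= -?ur //.
    by apply: path_simplexP => m a t /=; rewrite ?ur.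
  by apply: path_simplexP => m a t.
have ik_eq : is_equiv (scomp i k) by apply: is_equiv_comp => //; exact: hep_hpb.
split=> cmp_eq.
  apply: (is_equiv_cancel_l _ ik_eq); first exact: hep_hpb.
  by apply: is_equiv_eq E _; exact: is_equiv_comp.
apply: (is_equiv_cancel_l _ psi_eq); first exact: hep_hpb.
by rewrite (smapP E); exact: is_equiv_comp.
Qed.
End Pasting.

(** * Contractible fibres and connectedness *)

Lemma hep_point : hep point.
Proof. by apply: kan_hep => n k y _; exists tt => i _; case: (y i). Qed.

Lemma contractible_extends (K U V : sset) (i : smap U V) (F : smap U K) :
  hep K -> contractible K -> (forall n, injective (i n)) ->
  exists H : smap V K, forall n u, H n (i n u) = F n u.
Proof.
move=> Kh Kc i_inj.
have /liftsP L := is_equiv_weq Kh hep_point Kc.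
have unitE n (x y : point n) : x = y by case: x y => [] [].
pose F' := @hpb_mk _ _ _ (to_point K) (sid point) U F (to_point U)
  (scomp (cpath point) (to_point U)) (fun _ _ => unitE _ _ _) (fun _ _ => unitE _ _ _).
have [|H [HF _]] := L U V i F' (to_point V) i_inj; first by [].
exists (scomp (hpb_fst _ _) H) => n u.
exact: (congr1 (@hpb1 _ _ _ _ _ _) (HF n u)).
Qed.

Definition yoneda (K : sset) n (x : K n) : smap (simplex n) K :=
  @SMap (simplex n) K (fun m a => act a x) (fun _ _ f a => act_comp a f x).

(** Having a standard simplex as the target is the point: it can be contracted to a vertex, as in
    [corestrict_equiv]. *)
Lemma fillsP (E B : sset) (p : smap E B) :
  (forall (U : sset) n (i : smap U (simplex n)) (F : smap U E) (b : B n),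
     (forall m, injective (i m)) ->
     (forall m u, p m (F m u) = act (i m u) b) ->
     exists H : smap (simplex n) E, (forall m u, H m (i m u) = F m u) /\
       forall m a, p m (H m a) = act a b) ->
  fills p.
Proof.
move=> pL n b F Fact Fb.
pose R : srel (simplex n) E := fun m a x => exists na, x = F m a na.
have Rcl m k (f : dmap m k) (a : simplex n k) (x : E k) :
    @R k a x -> @R m (act f a) (act f x).
  move=> [na ->]; have naf : ~ onto (dcomp a f) by move/dcomp_onto.
  by exists naf; rewrite -(Fact _ _ _ _ _ naf).
have [||H [HF Hb]] := pL (graph Rcl) n (graph_fst Rcl) (graph_snd Rcl) b.
- move=> m [[a x] /= [na xE]] [[a' x'] /= [na' xE']] /= e.
  apply: graph_simplexP => /=; move: e na xE na' xE' => <- na -> na' ->.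
  by rewrite (Prop_irrelevance na na').
- by move=> m [[a x] /= [na ->]].
exists (H n (did n)); split=> [|m a na]; first by rewrite Hb act_id.
rewrite -sapp_act /= dcomp_idl.
by apply: (HF m (exist _ (a, F m a na) _)); exists na.
Qed.

Section Contraction.
Variable n : nat.

Fact scale_bound m (a : dmap m n) (t : dmap m 1) (p : nat) :
  p <= m -> t (inord p) * a (inord p) <= n.
Proof.
move=> _; have := ltn_ord (t (inord p)); have := ltn_ord (a (inord p)).
by case: (nat_of_ord (t _)) => [|[|]] //; rewrite mul1n.
Qed.

Fact scale_mono m (a : dmap m n) (t : dmap m 1) p q : p <= q -> q <= m ->
  t (inord p) * a (inord p) <= t (inord q) * a (inord q).
Proof.
move=> le_pq le_qm; apply: leq_mul; apply: dmap_le; rewrite !inordK ?ltnS //;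
  exact: leq_trans le_pq le_qm.
Qed.

(* The contraction of the n-simplex to its vertex 0. *)
Definition scale m (a : dmap m n) (t : dmap m 1) : dmap m n :=
  dmk (@scale_bound m a t) (@scale_mono m a t).

Lemma scaleE m (a : dmap m n) (t : dmap m 1) p : scale a t p = t p * a p :> nat.
Proof. by rewrite dmkE inord_val. Qed.

Lemma scale_comp m k (f : dmap k m) (a : dmap m n) (t : dmap m 1) :
  scale (dcomp a f) (dcomp t f) = dcomp (scale a t) f.
Proof.
by apply: dmapP => p; apply: ord_inj; rewrite dcompE !scaleE !dcompE.
Qed.

Variables (L : sset) (l : L n).

Fact contraction_act m k (f : dmap k m) (x : sprod (simplex n) (simplex 1) m) :
  act (scale (act f x).1 (act f x).2) l = act f (act (scale x.1 x.2) l).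
Proof. by rewrite -act_comp -scale_comp. Qed.

Definition contraction : smap (simplex n) (path_space L) :=
  curry (@SMap (sprod (simplex n) (simplex 1)) L (fun m x => act (scale x.1 x.2) l)
    (fun m k f x => contraction_act f x)).

Lemma contraction_start m (a : simplex n m) :
  path_end ord0 (contraction m a) = const_simplex m (vertex ord0 l).
Proof.
rewrite /path_end /= /const_simplex /vertex -act_comp dconst_comp.
by congr act; apply: dmapP => p; apply: ord_inj; rewrite scaleE !dmkE mul0n.
Qed.

Lemma contraction_end m (a : simplex n m) :
  path_end ord_max (contraction m a) = act a l.
Proof.
rewrite /path_end /=; congr act; apply: dmapP => p; apply: ord_inj.
by rewrite scaleE !dcompE !didE dmkE mul1n.
Qed.
End Contraction.

Section FullPath.
Variables (V L : sset) (P : L 0 -> Prop) (h : smap V (path_space L)).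
Hypothesis Pcl : forall x y : L 0, connected x y -> P x -> P y.
Hypothesis hP : forall v, P (path_end ord0 (h 0 v)).

(** Every vertex occurring in the path lies on the path over a vertex [w] of [v], at a time [s]. The
    initial stretch [r] of that path, from 0 to [s], connects it to the start, where [P] is
    known. *)
Fact fullpath_in n (v : V n) m (a : dmap m n) (t : dmap m 1) j :
  P (vertex j (pfun (h n v) a t)).
Proof.
set s := dcomp t (dconst 0 j); set w := act (dcomp a (dconst 0 j)) v.
have -> : vertex j (pfun (h n v) a t) = pfun (h 0 w) (did 0) s.
  by rewrite /w sapp_act pfun_did /vertex -pfun_act.
have [|r rE] := @dmap_of_fun 1 1 (fun p => if p == ord0 then ord0 else s ord0).
  move=> p q; case: eqP => [->//|p0]; case: eqP => [->|//].
  by rewrite leqn0 => /eqP e; case: p0; apply: ord_inj.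
apply: Pcl (hP w); exists (pfun (h 0 w) (dconst 1 ord0) r); split.
  rewrite -pfun_act /path_end; congr pfun.
    exact: dmap0P.
  apply: dmapP => i; apply: ord_inj; rewrite dcompE rE dmkE.
  by rewrite (_ : face 0 1 i = ord0) ?eqxx //; apply: ord_inj; rewrite dmkE (ord1 i).
rewrite -pfun_act; congr pfun.
  exact: dmap0P.
apply: dmapP => i; rewrite dcompE rE (ord1 i) ifN //.
by apply/eqP => /(congr1 (@nat_of_ord _)); rewrite dmkE.
Qed.

Fact fullpath_pfun n (v : V n) m m' (k : dmap m' m) (a : dmap m n) (t : dmap m 1) :
  exist _ (pfun (h n v) (dcomp a k) (dcomp t k)) (fullpath_in v (dcomp a k) (dcomp t k)) =
  act k (exist _ (pfun (h n v) a t) (fullpath_in v a t) : fullsub P m).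
Proof. by apply: fullsub_simplexP; rewrite /= pfun_act. Qed.

Definition fullpath_fun n (v : V n) : path_space (fullsub P) n :=
  @PathSimplex (fullsub P) n (fun m a t => exist _ (pfun (h n v) a t) (fullpath_in v a t))
    (@fullpath_pfun n v).

Fact fullpath_act m n (k : dmap m n) (v : V n) :
  fullpath_fun (act k v) = act k (fullpath_fun v).
Proof.
by apply: path_simplexP => l a t; apply: fullsub_simplexP; rewrite /= sapp_act.
Qed.

Definition fullpath : smap V (path_space (fullsub P)) := SMap fullpath_act.
End FullPath.

(** Contracting the simplex [l] to its initial vertex [y0] moves the partial data into the fibre
    over [y0], which is contractible since [y0] satisfies [P]; there they extend to the whole
    simplex. The square [T] carries the extension back over [l]. *)
Lemma corestrict_equiv (K L : sset) (f : smap K L) (P : L 0 -> Prop)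
    (fP : forall n (x : K n) j, P (vertex j (f n x))) :
  hep K -> hep L -> (forall x y, connected x y -> P x -> P y) ->
  (forall y, P y -> contractible (fibre f y)) -> is_equiv (corestrict fP).
Proof.
move=> Kh Lh Pcl fibc; apply/weq_is_equiv/fills_lifts/fillsP => U n i F l i_inj Fl.
pose k := scomp (hpb_fst _ _) F.
pose h := scomp (pmap (fullsub_incl P)) (scomp (hpb_pth _ _) F).
have h0 m u : path_end ord0 (h m u) = f m (k m u).
  exact: (congr1 sval (hpb_start (F m u))).
have h1 m u : path_end ord_max (h m u) = act (i m u) (sval l).
  by rewrite [LHS](congr1 sval (hpb_end (F m u))) [hpb2 _]Fl.
pose c := contraction (sval l); pose y0 := vertex ord0 (sval l).
have [||S [S0 S1 Sh]] := @lift_cyl0 _ _ (pend L ord_max) U (scomp (cpath L) (scomp f k))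
  (scomp c i) h (Lh _).
- by move=> m u; rewrite h0 [LHS]path_end_const.
- by move=> m u; rewrite h1 [LHS]contraction_end.
have S0' m u : path_end ord0 (pmap (pend L ord0) m (S m u)) = f m (k m u).
  by rewrite path_end_pmap S0 [LHS]path_end_const.
have S1' m u : path_end ord_max (pmap (pend L ord0) m (S m u)) =
    pick_point y0 m (to_point U m u).
  by rewrite path_end_pmap S1 [LHS]contraction_start.
have fh : hep (fibre f y0) by apply: hep_hpb => //; exact: hep_point.
have [W WF] := contractible_extends (@hpb_mk _ _ _ f (pick_point y0) U k (to_point U)
  (scomp (pmap (pend L ord0)) S) S0' S1') fh (fibc y0 (svalP l ord0)) i_inj.
pose k' := scomp (hpb_fst _ _) W.
have k'k m u : k' m (i m u) = k m u by exact: (congr1 (@hpb1 _ _ _ _ _ _) (WF m u)).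
have [|||||T [T0 T1 TS _]] := @lift_cyl _ _ (pend L ord0) U _ i
  (scomp (cpath L) (scomp f k')) c S (scomp (hpb_pth _ _) W) (Lh _) i_inj.
- by move=> m v; rewrite [RHS]hpb_start [LHS]path_end_const.
- by move=> m v; rewrite [RHS]hpb_end [LHS]contraction_start.
- move=> m u; rewrite S0.
  exact: (congr1 (fun x => const_path (f m x)) (esym (k'k m u))).
- by move=> m u; rewrite S1.
- by move=> m u; rewrite /= WF.
pose h' := scomp (pmap (pend L ord_max)) T.
have h'0 m v : path_end ord0 (h' m v) = f m (k' m v).
  by rewrite [LHS]path_end_pmap T0 [LHS]path_end_const.
have h'1 m v : path_end ord_max (h' m v) = act v (sval l).
  by rewrite [LHS]path_end_pmap T1 [LHS]contraction_end.
have h'h m u : h' m (i m u) = h m u by rewrite -Sh; exact: (congr1 (pmap (pend L ord_max) m) (TS m u)).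
have h'P v : P (path_end ord0 (h' 0 v)).
  rewrite h'0; have := fP 0 (k' 0 v) ord0; congr P.
  by rewrite -[RHS]act_id /vertex; congr act; exact: dmap0P.
pose g := fullpath Pcl h'P.
have g0 m v : path_end ord0 (g m v) = corestrict fP m (k' m v).
  by apply: fullsub_simplexP; exact: h'0.
have g1 m v : path_end ord_max (g m v) = yoneda l m v.
  by apply: fullsub_simplexP; exact: h'1.
exists (@hpb_mk _ _ _ (corestrict fP) (sid _) _ k' (yoneda l) g g0 g1).
split=> m u //; apply: hpb_simplexP; [exact: k'k|exact/esym/Fl|].
apply: path_simplexP => m' a t; apply: fullsub_simplexP.
exact: (congr1 (fun p : path_simplex _ _ => pfun p a t) (h'h m u)).
Qed.

(** Symmetry and transitivity of connectedness are thus inherited from homotopies. *)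
Lemma connectedP (K : sset) (x y : K 0) :
  connected x y <-> homotopic (pick_point x) (pick_point y).
Proof.
split=> [[p [p0 p1]]|[h hP]].
  have hp m m' (g : dmap m' m) (a : dmap m 0) (t : dmap m 1) :
      act (dcomp t g) p = act g (act t p) by exact: act_comp.
  pose q : path_space K 0 := @PathSimplex K 0 (fun m a t => act t p) hp.
  have q0 : path_end ord0 q = x.
    rewrite -p0 /path_end /=; congr act; apply: dmapP => i; apply: ord_inj.
    by rewrite !dmkE (ord1 i).
  have q1 : path_end ord_max q = y.
    rewrite -p1 /path_end /=; congr act; apply: dmapP => i; apply: ord_inj.
    by rewrite !dmkE (ord1 i).
  by exists (pick_point q) => m []; rewrite !(path_end_act (dconst m ord0)) q0 q1.
have [h0 h1] := hP 0 tt.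
exists (pfun (h 0 tt) (dconst 1 ord0) (did 1)); split; rewrite -pfun_act dconst_comp dcomp_idl.
  rewrite -[RHS]const_simplex0 -[RHS]h0 /path_end; congr pfun; first exact: dmap0P.
  by apply: dmapP => i; apply: ord_inj; rewrite !dmkE (ord1 i).
rewrite -[RHS]const_simplex0 -[RHS]h1 /path_end; congr pfun; first exact: dmap0P.
by apply: dmapP => i; apply: ord_inj; rewrite !dmkE (ord1 i).
Qed.

Lemma connected_sym (K : sset) (x y : K 0) : hep K -> connected x y -> connected y x.
Proof. by move=> Kh /connectedP/(homotopic_sym Kh)/connectedP. Qed.

Lemma connected_trans (K : sset) (x y z : K 0) :
  hep K -> connected x y -> connected y z -> connected x z.
Proof.
by move=> Kh /connectedP xy /connectedP yz; apply/connectedP; exact: homotopic_trans yz.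
Qed.

Lemma connected_path (K : sset) (p : path_space K 0) :
  connected (path_end ord0 p) (path_end ord_max p).
Proof.
apply/connectedP; exists (pick_point p) => n [].
by rewrite !(path_end_act (dconst n ord0)).
Qed.

Lemma path_connected (K : sset) (x y : K 0) : connected x y ->
  exists p : path_space K 0, path_end ord0 p = x /\ path_end ord_max p = y.
Proof.
move=> /connectedP[h hP]; exists (h 0 tt); have [-> ->] := hP 0 tt.
by rewrite /= !const_simplex0.
Qed.

Lemma connected_refl (K : sset) (x : K 0) : connected x x.
Proof. by apply/connectedP; exact: homotopic_eq. Qed.

Lemma connected_smap (K L : sset) (f : smap K L) (x y : K 0) :
  connected x y -> connected (f 0 x) (f 0 y).
Proof. by move=> [p [<- <-]]; exists (f 1 p); rewrite /is_path -!sapp_act. Qed.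

(** This surjectivity on components is all that the Rezk argument takes from the decomposition
    squares. *)
Lemma pullback_connected (A B C D : sset) (p : smap A B) (q : smap A C)
    (f : smap B D) (g : smap C D) (x : B 0) (y : C 0) :
  is_pullback p q f g -> connected (f 0 x) (g 0 y) ->
  exists a : A 0, connected (p 0 a) x /\ connected (q 0 a) y.
Proof.
move=> [e [s [_ [H HP]]]] /path_connected[w [w0 w1]].
pose z : hpb f g 0 := HpbSimplex w0 w1; exists (s 0 z).
have [H0 H1] := HP 0 z; have Hc := connected_path (H 0 z).
rewrite H0 H1 in Hc; split.
  exact: (connected_smap (hpb_fst f g) Hc).
exact: (connected_smap (hpb_snd f g) Hc).
Qed.

(** * The Segal squares of an interval *)

Lemma hep_ob (C : category) (X : diagram C) a : hep (X a).
Proof. exact/kan_hep/dob_kan. Qed.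

Lemma dmor_scomp (C : category) (X : diagram C) a b c (g : hom b c) (f : hom a b) :
  scomp (dmor X f) (dmor X g) = dmor X (comp g f).
Proof. by apply: smapP => n x; rewrite dmor_comp. Qed.

Lemma op_comp (X : simplicial_space) m n k (g : dmap n k) (f : dmap m n) l (x : X k l) :
  op X f l (op X g l x) = op X (dcomp g f) l x.
Proof. by rewrite /op -dmor_comp. Qed.

Fact glue_bound n p : p <= 2 -> (if p == 0 then 0 else n + p) <= n.+2.
Proof. by case: eqP; lia. Qed.

Fact glue_mono n p q : p <= q -> q <= 2 ->
  (if p == 0 then 0 else n + p) <= (if q == 0 then 0 else n + q).
Proof. by do 2 case: eqP; lia. Qed.

Definition glue n : dmap 2 n.+2 := dmk (@glue_bound n) (@glue_mono n).

(** A simplex with a triangle glued onto its long edge: the long edge is active, and the first edge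
    of a triangle is inert. *)
Lemma pushout_glue n : @is_pushout Delta 1 n.+1 2 n.+2
  (long_edge n.+1) (face 1 2) (face n.+1 n.+2) (glue n).
Proof.
split=> [|e u v uv].
  apply: dmapP => i; apply: ord_inj; rewrite !dcompE !dmkE /bump.
  by have := ltn_ord i; case: (nat_of_ord i) => [|[|]] //= _; rewrite ?mul1n; lia.
have uvE (i : 'I_2) : u (long_edge n.+1 i) = v (face 1 2 i).
  by rewrite -!dcompE [dcomp u _]uv.
have u0 : u ord_max = v (inord 1).
  have := uvE ord_max; congr (u _ = v _); apply: ord_inj; rewrite dmkE ?mul1n //.
  by rewrite inordK.
have [|w wE] := @dmap_of_fun n.+2 e
  (fun p => if p <= n.+1 then u (inord p) else v ord_max).
  move=> p q le_pq; case: (leqP q n.+1) => [le_q|lt_q].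
    by rewrite (leq_trans le_pq le_q) dmap_le // !inordK ?ltnS // (leq_trans le_pq).
  case: ifP => // le_p; apply: leq_trans (_ : u ord_max <= _).
    by rewrite dmap_le //= -ltnS.
  by rewrite u0 dmap_le // inordK.
have wf : dcomp w (face n.+1 n.+2) = u.
  apply: dmapP => i; rewrite dcompE wE.
  have -> : face n.+1 n.+2 i = i :> nat.
    by rewrite dmkE /bump leqNgt ltn_ord.
  by rewrite leq_ord inord_val.
have wg : dcomp w (glue n) = v.
  apply: dmapP => i; rewrite dcompE wE dmkE.
  case: i => [[|[|[|//]]] lt_i] /=.
  - transitivity (u (long_edge n.+1 ord0)).
      by congr (u _); apply: ord_inj; rewrite inordK ?dmkE.
    by rewrite uvE; congr (v _); apply: ord_inj; rewrite dmkE.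
  - rewrite addn1 leqnn (_ : inord n.+1 = ord_max); last first.
      by apply: ord_inj; rewrite inordK.
    by rewrite u0; congr (v _); apply: ord_inj; rewrite inordK.
  - by rewrite addn2 ltnn; congr (v _); apply: ord_inj.
exists w; split=> // w' [w'f w'g]; apply: dmapP => p.
case: (ltngtP p n.+2) => [lt_p|lt_p|p_eq].
- have -> : p = face n.+1 n.+2 (inord p).
    by apply: ord_inj; rewrite dmkE inordK // /bump leqNgt lt_p.
  by rewrite -!dcompE wf [dcomp w' _]w'f.
- by have := ltn_ord p; lia.
- have -> : p = glue n ord_max by apply: ord_inj; rewrite dmkE p_eq /= addn2.
  by rewrite -!dcompE wg [dcomp w' _]w'g.
Qed.

Definition degen_last : dmap 2 1 := dmk (@stop_bound 1) (@stop_mono 1).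

(** In a decomposition space this square says that a triangle whose second short edge is degenerate
    is itself degenerate. *)
Lemma pushout_unit : @is_pushout Delta 1 0 2 1
  (degen0 0) (face 1 0) (face 0 0) degen_last.
Proof.
split=> [|e u v uv].
  apply: dmapP => i; apply: ord_inj; rewrite !dcompE !dmkE /bump.
  by have := ltn_ord i; case: (nat_of_ord i) => [|[|]].
have uvE (i : 'I_2) : u ord0 = v (face 1 0 i).
  rewrite -dcompE -[RHS](congr1 (fun f : dmap 1 e => f i) uv) dcompE.
  by congr (u _); apply: ord_inj; rewrite dmkE; case: i => [[|[|]]].
exists (dcomp v (face 1 2)); split.
  split; apply: dmapP => i; rewrite !dcompE.
    transitivity (v (face 1 0 ord0)); last by rewrite -uvE (ord1 i).
    by congr (v _); apply: ord_inj; rewrite !dmkE (ord1 i).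
  case: i => [[|[|[|//]]] lt_i].
  - by congr (v _); apply: ord_inj; rewrite !dmkE.
  - by congr (v _); apply: ord_inj; rewrite !dmkE.
  - transitivity (v (face 1 0 ord0)).
      by congr (v _); apply: ord_inj; rewrite !dmkE.
    by rewrite -uvE (uvE ord_max); congr (v _); apply: ord_inj; rewrite !dmkE.
move=> w' [w'f w'g]; apply: dmapP => p; rewrite -[v]w'g !dcompE; congr (w' _).
by apply: ord_inj; rewrite !dmkE; case: p => [[|[|]]].
Qed.

Lemma decomposition_glue (X : simplicial_space) n : decomposition_space X ->
  is_pullback (op X (face n.+1 n.+2)) (op X (glue n))
    (op X (long_edge n.+1)) (op X (face 1 2)).
Proof.
move=> XD; apply: XD (@pushout_glue n).
  by apply/andP; split; apply/eqP/ord_inj; rewrite dmkE //= mul1n.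
by move=> i; rewrite !dmkE (ord1 i).
Qed.

Lemma decomposition_unit (X : simplicial_space) : decomposition_space X ->
  is_pullback (op X (face 0 0)) (op X degen_last) (s0 X) (d X 1 0).
Proof.
move=> XD; apply: XD pushout_unit; first by apply/andP; split; apply/eqP/ord_inj; rewrite dmkE.
by move=> i; rewrite !dmkE (ord1 i).
Qed.

Definition segal_square (X : simplicial_space) n : Prop :=
  is_pullback (d X n n.+1) (op X (principal_edge (ord_max : 'I_n.+1)))
    (op X (dconst 0 (ord_max : 'I_n.+1))) (d X 0 1).

Lemma segal_square_comm (X : simplicial_space) n m (x : X n.+1 m) :
  op X (dconst 0 (ord_max : 'I_n.+1)) m (d X n n.+1 m x) =
  d X 0 1 m (op X (principal_edge (ord_max : 'I_n.+1)) m x).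
Proof.
rewrite /d !op_comp; congr (op X _ m x).
apply: dmapP => i; apply: ord_inj; rewrite !dcompE !dmkE /= (ord1 i) /bump /=; lia.
Qed.

Lemma segal_square_span (X Y : simplicial_space) n :
  equivalent X Y -> segal_square Y n -> segal_square X n.
Proof.
move=> [Z [s [t st]]].
have tr (W : simplicial_space) (r : transformation Z W) : (forall a, is_equiv (r a)) ->
    segal_square Z n <-> segal_square W n.
  move=> r_eq; apply: (@is_pullback_equiv _ _ _ _ _ _ _ _ _ _ _ _ _ _ _ _
    (r n.+1) (r n) (r 1) (r 0)); try exact: hep_ob; try exact: r_eq;
    try exact: (@segal_square_comm _ n); by move=> m x; exact: tnat.
move=> Yn; apply/(tr X s); first by move=> a; exact: (st a).1.
by apply/(tr Y t) => // a; exact: (st a).2.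
Qed.

Lemma extE m n (f : dmap m n) p : val (ext f) p = ext_fun f p :> nat.
Proof. by rewrite dmkE. Qed.

Lemma xcompE m n k (g : xmap n k) (f : xmap m n) p :
  val (@comp Xi m n k g f) p = val g (val f p).
Proof. exact: dcompE. Qed.

Lemma xsbotE n p : val (xsbot n) p = p.-1 :> nat.
Proof. exact: dmkE. Qed.

Lemma ext_face_top n : ext (face n n.+1) = xdtop n.+1.
Proof.
apply/val_inj/dmapP => p; apply: ord_inj; rewrite extE dmkE.
have := ltn_ord p; case: (nat_of_ord p) => [|q] //= lt_q.
case: leqP => le_q; last by rewrite /bump; lia.
by rewrite ffunE /= inordK ?ltnS // /bump; lia.
Qed.

Lemma interval_segal_square (A : diagram Xi) n :
  flanked_decomposition_space A -> segal_square (i_star A) n.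
Proof.
move=> [Af AD]; have hepA k : hep (A k) by exact: hep_ob.
(* As the n-simplices of [i_star A] are [A n.+1], [left] relates its dimensions n, n + 1 and n + 2,
   and [right] its dimensions 0, 1 and 2. The maps [xsbot] prepend the bottom as initial vertex. *)
have [left _] := Af n.+1; have [right _] := Af 1.
have back := decomposition_glue n AD.
have topE k : op (i_star A) (face k k.+1) = xi_op A (xdtop k.+1).
  by rewrite /op /= ext_face_top.
rewrite !topE in back; rewrite /segal_square /d !topE.
have lr k m (x : A k.+1 m) : xi_op A (xsbot k) m (xi_op A (xdtop k) m x) =
    xi_op A (xdtop k.+1) m (xi_op A (xsbot k.+1) m x).
  by have [[e _] _] := Af k; exact: e.
have outer := (pullback_paste (lr n.+1) (hepA _) (hepA _) (hepA _) (hepA _) (hepA _)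
  (hepA _) back).1 left.
have front_comm m (x : A n.+2 m) : op (i_star A) (dconst 0 (ord_max : 'I_n.+1)) m
    (xi_op A (xdtop n.+1) m x) =
    xi_op A (xdtop 1) m (op (i_star A) (principal_edge (ord_max : 'I_n.+1)) m x).
  by rewrite -!topE; exact: (@segal_square_comm (i_star A)).
apply/(pullback_paste front_comm (hepA _) (hepA _) (hepA _) (hepA _) (hepA _)
  (hepA _) right).
(* Prepending the bottom to the last edge yields the triangle [glue n] of the enlarged simplex;
   prepending it to the last vertex yields, in [E2], the long edge. *)
have E1 : scomp (xi_op A (xsbot 2)) (op (i_star A) (principal_edge (ord_max : 'I_n.+1))) =
    scomp (op (i_star A) (glue n)) (xi_op A (xsbot n.+2)).
  rewrite /op /xi_op /= !(@dmor_scomp Xi); congr dmor; apply/val_inj/dmapP => p.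
  apply: ord_inj; rewrite !xcompE extE !xsbotE extE.
  case: p => [[|[|[|[|[|//]]]]] lt_p]; rewrite /= ?ffunE /= ?inordK //=; lia.
have E2 : scomp (xi_op A (xsbot 1)) (op (i_star A) (dconst 0 (ord_max : 'I_n.+1))) =
    scomp (op (i_star A) (long_edge n.+1)) (xi_op A (xsbot n.+1)).
  rewrite /op /xi_op /= !(@dmor_scomp Xi); congr dmor; apply/val_inj/dmapP => p.
  apply: ord_inj; rewrite !xcompE extE !xsbotE extE.
  case: p => [[|[|[|[|//]]]] lt_p]; rewrite /= ?ffunE /= ?inordK //=; lia.
by rewrite E1 E2.
Qed.

(** * Spines and equivalences *)

Lemma hep_iso (K L : sset) (r : smap K L) (s : smap L K) :
  (forall n x, r n (s n x) = x) -> hep K -> hep L.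
Proof.
move=> rs Kh e; apply/liftsP => U V i F G i_inj FG.
have [|H [HF HG]] := (liftsP _).1 (Kh e) U V i (scomp (pmap s) F) (scomp s G) i_inj.
  by move=> n u; rewrite /= -FG.
exists (scomp (pmap r) H); split=> n v.
  by rewrite /= HF; apply: path_simplexP => m a t; exact: rs.
by rewrite -[RHS]rs -[s n _]HG.
Qed.

Section Spine.
Variable X : simplicial_space.

Definition spine_edge n (i : 'I_n.+1) : smap (spine X n) (X 1) :=
  @SMap (spine X n) (X 1) (fun m s => sp_edge s i) (fun _ _ _ _ => erefl).

Definition spine_target n : smap (spine X n) (X 0) :=
  scomp (d X 0 0) (spine_edge (ord_max : 'I_n.+1)).

(** Spines with one more edge: [spine_split] and [spine_join] below are mutually inverse. *)
Let S n := hpb (spine_target n) (d X 0 1).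

Lemma lift0_ord_max n : lift ord0 (ord_max : 'I_n.+1) = ord_max.
Proof. by apply: ord_inj; rewrite lift0. Qed.

Lemma lift0_lift_max n (i : 'I_n) :
  lift ord0 (lift ord_max i : 'I_n.+1) = lift ord_max (lift ord0 i).
Proof. by apply: ord_inj; rewrite lift0 !lift_max. Qed.

Section Split.
Variables (n m : nat) (s : spine X n.+1 m).

Fact spine_init_start (i : 'I_n) : path_end ord0 (sp_path s (lift ord_max i)) =
  d X 0 0 m (sp_edge s (lift ord_max (lift ord_max i))).
Proof. exact: sp_start. Qed.

Fact spine_init_end (i : 'I_n) : path_end ord_max (sp_path s (lift ord_max i)) =
  d X 0 1 m (sp_edge s (lift ord_max (lift ord0 i))).
Proof. by rewrite sp_end lift0_lift_max. Qed.

Definition spine_init : spine X n m :=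
  @SpineSimplex X n m (fun i => sp_edge s (lift ord_max i))
    (fun i => sp_path s (lift ord_max i)) spine_init_start spine_init_end.

Fact spine_split_end : path_end ord_max (sp_path s ord_max) =
  d X 0 1 m (sp_edge s ord_max).
Proof. by rewrite sp_end lift0_ord_max. Qed.

Definition spine_split_fun : S n m :=
  @HpbSimplex _ _ _ (spine_target n) (d X 0 1) m spine_init (sp_edge s ord_max)
    (sp_path s ord_max) (sp_start s ord_max) spine_split_end.
End Split.

Fact spine_split_act n k m (h : dmap k m) (s : spine X n.+1 m) :
  spine_split_fun (act h s) = act h (spine_split_fun s).
Proof. by apply: hpb_simplexP => //; exact: spine_simplexP. Qed.

Definition spine_split n : smap (spine X n.+1) (S n) := SMap (@spine_split_act n).

Section Join.
Variables (n m : nat) (x : S n m).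

Definition join_edge (i : 'I_n.+2) : X 1 m :=
  if unlift ord_max i is Some j then sp_edge (hpb1 x) j else hpb2 x.
Definition join_path (i : 'I_n.+1) : path_space (X 0) m :=
  if unlift ord_max i is Some j then sp_path (hpb1 x) j else hpb_path x.

Fact join_start (i : 'I_n.+1) :
  path_end ord0 (join_path i) = d X 0 0 m (join_edge (lift ord_max i)).
Proof.
rewrite /join_edge liftK /join_path; case: unliftP => [j ->|->]; first exact: sp_start.
exact: hpb_start.
Qed.

Fact join_end (i : 'I_n.+1) :
  path_end ord_max (join_path i) = d X 0 1 m (join_edge (lift ord0 i)).
Proof.
rewrite /join_path; case: unliftP => [j ->|->].
  by rewrite lift0_lift_max /join_edge liftK; exact: sp_end.
by rewrite lift0_ord_max /join_edge unlift_none; exact: hpb_end.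
Qed.

Definition spine_join_fun : spine X n.+1 m := SpineSimplex join_start join_end.
End Join.

Fact spine_join_act n k m (h : dmap k m) (x : S n m) :
  spine_join_fun (act h x) = act h (spine_join_fun x).
Proof.
by apply: spine_simplexP => i; rewrite /= ?/join_edge ?/join_path; case: unlift.
Qed.

Definition spine_join n : smap (S n) (spine X n.+1) := SMap (@spine_join_act n).

Lemma spine_splitK n m x : spine_split n m (spine_join n m x) = x.
Proof.
apply: hpb_simplexP; rewrite /= ?/join_edge ?/join_path ?unlift_none //.
by apply: spine_simplexP => i; rewrite /= ?/join_edge ?/join_path liftK.
Qed.

Lemma spine_joinK n m s : spine_join n m (spine_split n m s) = s.
Proof.
by apply: spine_simplexP => i; rewrite /= ?/join_edge ?/join_path; case: unliftP => [j ->|->].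
Qed.

Lemma edge0 m (x : X 1 m) (i : 'I_1) : edge X i m x = x.
Proof.
rewrite /edge (_ : principal_edge i = did 1); first exact: (@dmor_id Delta).
by apply: dmapP => j; apply: ord_inj; rewrite !dmkE (ord1 i).
Qed.

Lemma spine_edge0K m (s : spine X 0 m) :
  spine_cmp X 0 m (spine_edge (ord0 : 'I_1) m s) = s.
Proof. by apply: spine_simplexP => [i|[]//]; rewrite /= edge0 (ord1 i). Qed.

Lemma spine0_equiv : is_equiv (spine_cmp X 0).
Proof.
apply: (is_equiv_iso (g := spine_edge (ord0 : 'I_1))) => m x; last exact: spine_edge0K.
exact: edge0.
Qed.

Lemma hep_spine n : hep (spine X n).
Proof.
elim: n => [|n IH].
  by apply: (@hep_iso (X 1) _ (spine_cmp X 0) (spine_edge ord0) spine_edge0K); exact: hep_ob.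
apply: (@hep_iso _ _ (spine_join n) (spine_split n) (@spine_joinK n)).
by apply: hep_hpb => //; exact: hep_ob.
Qed.

(** Once the last edge is split off, the comparison map is that of a Segal square followed by the
    map of homotopy pullbacks induced by the shorter comparison map, an equivalence by induction. *)
Lemma segal_of_squares : (forall n, segal_square X n.+1) -> segal X.
Proof.
move=> Xsq; elim=> [|n IH]; first exact: spine0_equiv.
have Eq := (is_pullbackP (@segal_square_comm X n.+1)).1 (Xsq n).
have c1 m (x : X n.+1 m) : sid (X 0) m (op X (dconst 0 (ord_max : 'I_n.+2)) m x) =
    spine_target n m (spine_cmp X n m x).
  rewrite /= /edge op_comp; congr (op X _ m x).
  by apply: dmapP => i; apply: ord_inj; rewrite !dcompE !dmkE (ord1 i) /= addn1.
have c2 m (x : X 1 m) : sid (X 0) m (d X 0 1 m x) = d X 0 1 m (sid (X 1) m x) by [].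
apply: (@is_equiv_cancel_l _ _ _ _ (spine_split n)); first exact: hep_spine.
  exact: (is_equiv_iso (@spine_joinK n) (@spine_splitK n)).
apply: (@is_equiv_eq _ _ (scomp (hpb_map c1 c2) (hpb_cmp (@segal_square_comm X n.+1)))).
  move=> m x; apply: hpb_simplexP => //.
    apply: spine_simplexP => i /=.
      rewrite /edge /d op_comp; congr (op X _ m x).
      apply: dmapP => j; apply: ord_inj; rewrite dcompE !dmkE /bump lift_max.
      by have := ltn_ord i; have := ltn_ord j; lia.
    congr const_path; congr (d X 0 0 m _).
    rewrite /edge /d op_comp; congr (op X _ m x).
    apply: dmapP => j; apply: ord_inj; rewrite dcompE !dmkE /bump !lift_max.
    by have := ltn_ord i; have := ltn_ord j; lia.
  apply: path_simplexP => k a t /=; rewrite -!sapp_act /edge /d !op_comp.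
  congr (op X _ k _); apply: dmapP => j; apply: ord_inj.
  by rewrite !dcompE !dmkE /bump !lift_max (ord1 j) /=; lia.
have Sh : hep (S n) by apply: hep_hpb; [exact: hep_spine|exact: hep_ob|exact: hep_ob].
apply: is_equiv_comp => //; first exact: hep_ob.
apply: hpb_map_equiv; rewrite //; try exact: is_equiv_id; try exact: hep_ob.
exact: hep_spine.
Qed.
End Spine.

(** * Tightness and Rezk completeness *)

Section Rezk.
Variable X : simplicial_space.
Hypotheses (XD : decomposition_space X) (Xt : tight X).

Let hepX n : hep (X n) := @hep_ob Delta X n.

Lemma degenerate_connected (a b : X 1 0) : connected a b -> degenerate a -> degenerate b.
Proof. by move=> ab [x xa]; exists x; apply: (connected_trans (@hepX 1) xa ab). Qed.

Lemma op_did n m (x : X n m) : op X (did n) m x = x.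
Proof. exact: (@dmor_id Delta). Qed.

(** The principal edges of the glued simplex are, up to paths, those of [s] followed by the last
    edge of [t], and its long edge is that of [t]. *)
Lemma glue_simplex n (s : X n.+1 0) (t : X 2 0) :
  edges_nondegenerate s -> ~ degenerate (d X 1 0 0 t) ->
  connected (op X (long_edge n.+1) 0 s) (d X 1 2 0 t) ->
  exists s' : X n.+2 0, edges_nondegenerate s' /\
    connected (op X (long_edge n.+2) 0 s') (d X 1 1 0 t).
Proof.
move=> s_nd t_nd st.
have [s' [s's s't]] := pullback_connected (decomposition_glue n XD) st.
exists s'; split=> [i i_deg|].
  have [lt_i|le_i] := ltnP i n.+1.
    apply: (s_nd (Ordinal lt_i)); apply: degenerate_connected i_deg.
    have := connected_smap (op X (principal_edge (Ordinal lt_i))) s's.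
    rewrite op_comp; congr (connected (op X _ 0 s') _).
    apply: dmapP => j; apply: ord_inj; rewrite dcompE !dmkE /bump /=.
    by have := ltn_ord j; lia.
  apply: t_nd; apply: degenerate_connected i_deg.
  have := connected_smap (d X 1 0) s't.
  rewrite /d op_comp; congr (connected (op X _ 0 s') _).
  apply: dmapP => j; apply: ord_inj; rewrite dcompE !dmkE /bump /=.
  by have := ltn_ord j; have := ltn_ord i; lia.
have := connected_smap (d X 1 1) s't.
rewrite /d op_comp; congr (connected (op X _ 0 s') _).
apply: dmapP => j; apply: ord_inj; rewrite dcompE !dmkE /bump /=.
by have := ltn_ord j; case: (nat_of_ord j) => [|[|]] //; rewrite mul1n addn2.
Qed.

(* Gluing t with the degenerate 2-simplex on its first edge, over and over,
   gives arbitrarily long nondegenerate simplices with that long edge. *)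
Lemma tight_face_degenerate (t : X 2 0) : degenerate (d X 1 1 0 t) ->
  degenerate (d X 1 2 0 t) \/ degenerate (d X 1 0 0 t).
Proof.
move=> t1; apply: contrapT => /not_orP[t2 t0].
have [f fE] : exists f, f = d X 1 2 0 t by eexists.
rewrite -fE in t2.
have [x xt1] := t1.
pose u := op X (degen0 1) 0 f.
have u0 : d X 1 0 0 u = f.
  rewrite /u /d op_comp -[RHS]op_did; congr (op X _ 0 f).
  by apply: dmapP => i; apply: ord_inj; rewrite dcompE !dmkE.
have u1 : d X 1 1 0 u = f.
  rewrite /u /d op_comp -[RHS]op_did; congr (op X _ 0 f).
  apply: dmapP => i; apply: ord_inj; rewrite dcompE !dmkE.
  by case: i => [[|[|]]].
have u2 : d X 1 2 0 u = s0 X 0 (d X 0 1 0 f).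
  rewrite /u /d /s0 !op_comp; congr (op X _ 0 f).
  apply: dmapP => i; apply: ord_inj; rewrite !dcompE !dmkE.
  by case: i => [[|[|]]].
(* The long edge of [t] starts where [f] does, so, being degenerate, it is the identity on the
   source of [f], which is also the first edge of [u]. *)
have tu : connected (d X 1 1 0 t) (d X 1 2 0 u).
  rewrite u2; apply: (connected_trans (@hepX 1) (connected_sym (@hepX 1) xt1)).
  apply: connected_smap.
  have := connected_smap (d X 0 1) xt1.
  rewrite fE /s0 /d !op_comp.
  have -> : dcomp (degen0 0) (face 0 1) = did 0.
    exact: dmap0P.
  rewrite op_did; congr (connected x (op X _ 0 t)).
  by apply: dmapP => i; apply: ord_inj; rewrite !dcompE !dmkE (ord1 i).
have [N XN] := Xt f.
(* One round glues [t] and then [u], adding two edges and returning the long edge to [f]. So k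
   rounds starting from the single edge [f] give 2k + 1 edges, with the bound of tightness always
   taken at [f]. *)
suff /(_ N)[s [s_nd /path_connected[p [p0 p1]]]] : forall k, exists s : X (k.*2.+1) 0,
    edges_nondegenerate s /\ connected (op X (long_edge k.*2.+1) 0 s) f.
  have Nle : N <= N.*2.+1 by rewrite -addnn; lia.
  have sP j : edges_nondegenerate (vertex j s).
    suff -> : vertex j s = s by [].
    by rewrite -[RHS]act_id; congr act; apply: dmapP => i; rewrite [LHS]ord1 [RHS]ord1.
  apply: (XN _ Nle 0).
  exact: (@HpbSimplex _ _ _ (nondegenerate_long_edge X _) (pick_point f) 0
    (exist _ s sP) tt p p0 (etrans p1 (esym (const_simplex0 f)))).
elim=> [|k [s [s_nd sf]]].
  exists f; split=> [i|]; last first.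
    rewrite (_ : long_edge 1 = did 1) ?op_did; first exact: connected_refl.
    by apply: dmapP => i; apply: ord_inj; rewrite !dmkE muln1.
  rewrite (_ : principal_edge i = did 1) ?op_did //.
  by apply: dmapP => j; apply: ord_inj; rewrite !dmkE (ord1 i).
rewrite fE in sf; have [s' [s'_nd s't]] := glue_simplex s_nd t0 sf.
have u0_nd : ~ degenerate (d X 1 0 0 u) by rewrite u0.
have [s'' []] := glue_simplex s'_nd u0_nd (connected_trans (@hepX 1) s't tu).
by rewrite u1; exists s''.
Qed.

(** The unit square puts [t] in the component of some [op X degen_last 0 a], whose first short edge
    and long edge both equal [a]. *)
Lemma unit_face_degenerate (t : X 2 0) : degenerate (d X 1 0 0 t) ->
  connected (d X 1 2 0 t) (d X 1 1 0 t).
Proof.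
move=> [x xt].
have [a [_ at_]] := pullback_connected (decomposition_unit XD) xt.
have e i : 0 < i -> i < 3 -> d X 1 i 0 (op X degen_last 0 a) = a.
  move=> i_gt0 i_lt; rewrite /d op_comp -[RHS]op_did; congr (op X _ 0 a).
  apply: dmapP => j; apply: ord_inj; rewrite dcompE !dmkE /bump.
  by have := ltn_ord j; lia.
have := connected_smap (d X 1 2) at_; have := connected_smap (d X 1 1) at_.
rewrite !e // => a1 a2.
exact: (connected_trans (@hepX 1) (connected_sym (@hepX 1) a2) a1).
Qed.

Lemma is_equivalence_degenerate (f : X 1 0) : is_equivalence f <-> degenerate f.
Proof.
split=> [[[t [p [q [[p0 p1] [q0 q1] _]]]] _]|[x [p [p0 p1]]]].
  have tf : connected (d X 1 2 0 t) f by exists p.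
  have t1 : degenerate (d X 1 1 0 t).
    by exists (d X 0 1 0 f); apply: (connected_sym (@hepX 1)); exists q.
  apply: degenerate_connected tf _.
  have [//|/unit_face_degenerate] := tight_face_degenerate t1.
  by move/(connected_sym (@hepX 1)) => t21; exact: degenerate_connected t21 t1.
pose t := op X (degen0 1) 0 (s0 X 0 x).
have tE i : d X 1 i 0 t = s0 X 0 x.
  rewrite /t /d /s0 !op_comp; congr (op X _ 0 x).
  exact: dmap0P.
have s0d i : i < 2 -> d X 0 i 0 (s0 X 0 x) = x.
  move=> i2; rewrite /d /s0 op_comp -[RHS]op_did; congr (op X _ 0 x).
  exact: dmap0P.
have refl_htpy (K : sset) (w : K 1) : path_homotopic w w.
  exists (act degen_last w); split.
  - rewrite -act_comp -[RHS]act_id; congr act; apply: dmapP => j; apply: ord_inj.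
    by rewrite dcompE !dmkE /bump; case: j => [[|[|]]].
  - rewrite -act_comp -[RHS]act_id; congr act; apply: dmapP => j; apply: ord_inj.
    by rewrite dcompE !dmkE /bump; case: j => [[|[|]]].
  - rewrite /const_simplex -!act_comp; congr act; apply: dmapP => j; apply: ord_inj.
    by rewrite !dcompE !dmkE /bump; case: j => [[|[|]]].
have side i : i < 2 -> exists q : X 1 1,
    is_path q (s0 X 0 x) (s0 X 0 (d X 0 i 0 f)) /\
    path_homotopic (d X 0 i 1 p) (d X 0 i 1 q).
  (* Applying [s0] to the path traced by an end of [f] gives a [q] with the same image under that
     face as [p], so reflexivity is the required homotopy. *)
  move=> i2; exists (s0 X 1 (d X 0 i 1 p)); split.
    by split; rewrite -!sapp_act ?p0 ?p1 ?s0d.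
  rewrite {2}/d {1}/s0 op_comp (_ : dcomp _ _ = did 0) ?op_did //.
  exact: dmap0P.
split.
  by have [q [qP pq]] := side 1 isT; exists t, p, q; rewrite !tE.
by have [q [qP pq]] := side 0 isT; exists t, p, q; rewrite !tE.
Qed.

Lemma tight_rezk_complete : complete X -> rezk_complete X.
Proof.
move=> Xc.
have s0P n (x : X 0 n) j : is_equivalence (vertex j (s0 X n x)).
  apply/is_equivalence_degenerate; exists (vertex j x).
  by rewrite /vertex sapp_act; exact: connected_refl.
exists s0P; apply: corestrict_equiv => [||x y xy|y].
- exact: hepX.
- exact: hepX.
- move=> /is_equivalence_degenerate x_deg.
  by apply/is_equivalence_degenerate; exact: degenerate_connected x_deg.
- move=> /is_equivalence_degenerate[x /path_connected[p [p0 p1]]].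
  (* The path from [s0 X 0 x] to [y] is a point of the fibre, which excludes the empty case of the
     monomorphism. *)
  have [E|//] := Xc y; case: (E 0).
  exact: (@HpbSimplex _ _ _ (s0 X) (pick_point y) 0 x tt p p0
    (etrans p1 (esym (const_simplex0 y)))).
Qed.
End Rezk.

Theorem proposition6p6 (X : simplicial_space) (HX : mobius_interval X) :
  rezk_complete_segal_space X.
Proof.
have [[A [[Afl _ _] XA]] [XD Xc _ Xt]] := HX.
split; last exact: tight_rezk_complete.
apply: segal_of_squares => n.
exact: segal_square_span XA (interval_segal_square _ Afl).
Qed.
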